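(* For each $n\ge 1$ let $\sigma_n$ be a uniformly random element of the set $Sq(n)$ of square permutations of size $n$, and let $z$ be a uniform random variable on $(0,1)$. Then, as $n\to\infty$, the random permuton $\mu_{\sigma_n}$ associated with $\sigma_n$ converges in distribution (with respect to the weak topology on the space of permutons) to the random permuton $\mu^{z}$.
   Context: Square permutations. For a permutation $\sigma$ of $[n]=\{1,\dots,n\}$, the point $(i,\sigma(i))$ is a left-to-right maximum (resp. minimum) if $\sigma(i)>\sigma(j)$ (resp. $\sigma(i)<\sigma(j)$) for all $j<i$, and a right-to-left maximum (resp. minimum) if $\sigma(i)>\sigma(j)$ (resp. $\sigma(i)<\sigma(j)$) for all $j>i$. A point is a record if it is of at least one of these four types. A permutation is square if each of its points is a record; $Sq(n)$ is the set of square permutations of size $n$. Permutons. A permuton is a Borel probability measure on $[0,1]^2$ with uniform marginals, i.e. $\mu([0,1]\times[a,b])=\mu([a,b]\times[0,1])=b-a$ for all $0\le a\le b\le1$. The space of permutons is equipped with the topology of weak convergence of measures (it is compact and metrizable). For a permutation $\sigma$ of size $n$, the permuton $\mu_\sigma$ is the measure equal to $n$ times Lebesgue measure on each of the squares $[(i-1)/n,i/n]\times[(\sigma(i)-1)/n,\sigma(i)/n]$, $i=1,\dots,n$, and zero elsewhere. The permuton $\mu^z$. For $z\in[0,1]$ let $L_1$ be the segment from $(0,z)$ to $(z,0)$, $L_2$ the segment from $(0,z)$ to $(1-z,1)$, $L_3$ the segment from $(z,0)$ to $(1,1-z)$, $L_4$ the segment from $(1-z,1)$ to $(1,1-z)$.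 For a Borel set $S\subseteq[0,1]^2$ put $\mu^z_i(S)=\frac12\nu(\pi_x(S\cap L_i))$, where $\nu$ is Lebesgue measure on $[0,1]$ and $\pi_x$ is the projection on the $x$-axis, and $\mu^z=\mu^z_1+\mu^z_2+\mu^z_3+\mu^z_4$. *)

(* Defs.v *)
From HB Require Import structures.
From mathcomp Require Import all_boot all_order all_algebra all_fingroup.
From mathcomp Require Import all_classical all_reals all_analysis.
From mathcomp Require Import measurable_realfun ring lra.

Set Implicit Arguments.
Unset Strict Implicit.
Unset Printing Implicit Defensive.

Import Order.TTheory GRing.Theory Num.Theory.
Import numFieldNormedType.Exports.

Local Open Scope classical_set_scope.
Local Open Scope ring_scope.

Section SquarePermutations.
Variable n : nat.
Implicit Types (s : 'S_n) (i : 'I_n).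

Definition lr_max s i := [forall j : 'I_n, (j < i)%N ==> (s j < s i)%N].
Definition lr_min s i := [forall j : 'I_n, (j < i)%N ==> (s i < s j)%N].
Definition rl_max s i := [forall j : 'I_n, (i < j)%N ==> (s j < s i)%N].
Definition rl_min s i := [forall j : 'I_n, (i < j)%N ==> (s i < s j)%N].

Definition is_record s i := [|| lr_max s i, lr_min s i, rl_max s i | rl_min s i].

Definition is_square s := [forall i, is_record s i].

End SquarePermutations.

Definition Sq (n : nat) : {set 'S_n} := [set s | is_square s].

(** [X] need not be declared measurable beforehand: the preimages of the points
    are required to be events. *)
Definition uniform_random (R : realType) (d : measure_display)
    (Om : measurableType d) (P : probability Om R) (T : finType)
    (X : Om -> T) (A : {set T}) : Prop :=
  forall t : T, measurable (X @^-1` [set t]) /\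
    P (X @^-1` [set t]) = ((t \in A)%:R / #|A|%:R)%:E.

Definition borel (S : ptopologicalType) := g_sigma_algebraType (@open S).

(** The random elements of [S] may all live on different probability spaces. *)
Definition cvg_in_distribution (R : realType) (S : ptopologicalType)
    (d_ : nat -> measure_display) (Om_ : forall n, measurableType (d_ n))
    (P_ : forall n, probability (Om_ n) R) (X_ : forall n, Om_ n -> S)
    (d : measure_display) (Om : measurableType d)
    (P : probability Om R) (X : Om -> S) : Prop :=
  [/\ forall n, measurable_fun [set: Om_ n] (X_ n : Om_ n -> borel S),
      measurable_fun [set: Om] (X : Om -> borel S) &
      forall phi : S -> R, continuous phi -> bounded_fun phi ->
        (\int[P_ n]_w phi (X_ n w)) @[n --> \oo] --> \int[P]_w phi (X w)].

(** [measurableTypeR R] is the carrier of [lebesgue_measure]. *)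
Notation plane R := (measurableTypeR R * measurableTypeR R)%type.

Section Permuton.
Variable R : realType.

Definition unit_square : set (R * R) := `[0, 1] `*` `[0, 1].

Definition uniform_marginals (mu : set (plane R) -> \bar R) : Prop :=
  forall a b : R, 0 <= a -> a <= b -> b <= 1 ->
    mu (`[0, 1] `*` `[a, b]) = (b - a)%:E /\
    mu (`[a, b] `*` `[0, 1]) = (b - a)%:E.

(** A Borel probability measure on the unit square is encoded as one on the
    plane; it is carried by [unit_square] by [uniform_marginals] at [a = 0],
    [b = 1].  Two permutons that agree on the measurable sets may differ as
    set functions on the others; they are topologically indistinguishable. *)
Record permuton := Permuton {
  permuton_measure :> probability (plane R) R ;
  permutonP : uniform_marginals permuton_measure }.

HB.instance Definition _ := gen_eqMixin permuton.
HB.instance Definition _ := gen_choiceMixin permuton.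

(** The topology of weak convergence is the coarsest one making the integrals
    of the continuous functions on the unit square continuous. *)
Definition test_function :=
  {f : R * R -> R | {within unit_square, continuous f}}.

Definition permuton_integral (mu : permuton) : {ptws test_function -> R} :=
  fun f => \int[mu]_(p in unit_square) sval f p.

HB.instance Definition _ :=
  Topological.copy permuton (initial_topology permuton_integral).

End Permuton.

Section Overlap.
Variable R : realType.
Implicit Types a b c d e u v : R.
Local Notation leb := (@lebesgue_measure R).

Definition overlap a b c d : R :=
  Num.max 0 (Num.min b d - Num.max a c).

Lemma lebesgue_overlap a b c d :
  leb (`[a, b] `&` `[c, d]) = (overlap a b c d)%:E.
Proof.
have -> : `[a, b] `&` `[c, d] = `[Num.max a c, Num.min b d]%classic.
  apply/seteqP; split=> x /=; rewrite !in_itv/= ge_max le_min.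
    by move=> [/andP[-> ->] /andP[-> ->]].
  by move=> /andP[/andP[-> ->] /andP[-> ->]].
rewrite lebesgue_measure_itv/= lte_fin /overlap -EFinD.
case: ifPn => [/ltW|]; first by rewrite -subr_ge0 => /max_r ->.
by rewrite -leNgt -subr_le0 => /max_l ->.
Qed.

Lemma overlap_cat a b c d e : c <= d -> d <= e ->
  overlap a b c d + overlap a b d e = overlap a b c e.
Proof.
move=> cd de; rewrite /overlap.
case: (leP b d) => ?; case: (leP b e) => ?; case: (leP a c) => ?;
  case: (leP a d) => ?; rewrite !maxEle; do ![case: leP => ?]; lra.
Qed.

Lemma overlap_sub a b c d : c <= a -> a <= b -> b <= d ->
  overlap a b c d = b - a.
Proof.
by move=> ca ab bd; rewrite /overlap (min_l bd) (max_l ca) max_r ?subr_ge0.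
Qed.

Lemma overlapC a b c d : overlap a b c d = overlap c d a b.
Proof. by rewrite /overlap (minC b) (maxC a). Qed.

Lemma overlap_shift a b c u v :
  overlap (a - c) (b - c) u v = overlap a b (u + c) (v + c).
Proof.
rewrite /overlap.
case: (leP (b - c) v) => ?; case: (leP b (v + c)) => ?;
  case: (leP (a - c) u) => ?; case: (leP a (u + c)) => ?;
  rewrite !maxEle; do ![case: leP => ?]; lra.
Qed.

Lemma overlap_refl a b c u v :
  overlap (c - b) (c - a) u v = overlap a b (c - v) (c - u).
Proof.
rewrite /overlap.
case: (leP (c - a) v) => ?; case: (leP b (c - u)) => ?;
  case: (leP (c - b) u) => ?; case: (leP a (c - v)) => ?;
  rewrite !maxEle; do ![case: leP => ?]; lra.
Qed.

Lemma sum_overlap (n : nat) a b : 0 <= a -> a <= b -> b <= 1 ->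
  \sum_(i < n.+1) overlap a b (i%:R / n.+1%:R) (i.+1%:R / n.+1%:R) = b - a.
Proof.
move=> a0 ab b1.
have H k : \sum_(i < k.+1) overlap a b (i%:R / n.+1%:R) (i.+1%:R / n.+1%:R) =
    overlap a b 0 (k.+1%:R / n.+1%:R).
  elim: k => [|k IH]; first by rewrite big_ord1 mul0r.
  rewrite big_ord_recr/= IH overlap_cat ?divr_ge0//.
  by rewrite ler_pM2r ?invr_gt0 ?ltr0n// ler_nat.
by rewrite H divff ?pnatr_eq0// overlap_sub.
Qed.

End Overlap.

Lemma eq_semi_sigma_additive (R : realType) (d : measure_display)
    (T : measurableType d) (m : set T -> \bar R) (nu : {measure set T -> \bar R}) :
  (forall A, measurable A -> m A = nu A) -> semi_sigma_additive m.
Proof.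
move=> mE F mF tF mUF; rewrite mE//.
under eq_fun do under eq_bigr do rewrite mE//.
exact: measure_semi_sigma_additive.
Qed.

Section PermMeasure.
Variables (R : realType) (n : nat) (s : 'S_n.+1).
Local Notation leb := (@lebesgue_measure R).

(** Indices start at [0]: the cell of [i : 'I_n] is that of the point
    [(i + 1, s i + 1)] in the numbering from [1]. *)
Definition perm_cell (i : 'I_n.+1) : set (plane R) :=
  `[i%:R / n.+1%:R, i.+1%:R / n.+1%:R] `*`
  `[(s i)%:R / n.+1%:R, (s i).+1%:R / n.+1%:R].

Definition perm_measure (S : set (plane R)) : \bar R :=
  (n.+1%:R%:E * \sum_(i < n.+1) (leb \x leb) (S `&` perm_cell i))%E.

Let mcell i : measurable (perm_cell i).
Proof. by apply: measurableX; exact: measurable_itv. Qed.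

Let cells (k : nat) : {measure set (plane R) -> \bar R} :=
  mrestr (leb \x leb)%E (mcell (inord k)).

Let perm_measureE S :
  perm_measure S = mscale (NngNum (ler0n R n.+1)) (msum cells n.+1) S.
Proof.
rewrite /perm_measure /mscale /msum; apply: (f_equal (mule _)).
by apply: eq_bigr => i _; rewrite /cells /mrestr inord_val.
Qed.

Let perm_measure0 : perm_measure set0 = 0%E.
Proof. by rewrite perm_measureE measure0. Qed.

Let perm_measure_ge0 S : (0 <= perm_measure S)%E.
Proof. by rewrite perm_measureE measure_ge0. Qed.

Let perm_measure_sigma_additive : semi_sigma_additive perm_measure.
Proof. by apply: eq_semi_sigma_additive => A _; exact: perm_measureE. Qed.

HB.instance Definition _ := isMeasure.Build _ _ _ perm_measure
  perm_measure0 perm_measure_ge0 perm_measure_sigma_additive.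

Let perm_measure_rect a b c e :
  perm_measure (`[a, b] `*` `[c, e]) = (n.+1%:R * \sum_(i < n.+1)
    overlap a b (i%:R / n.+1%:R) (i.+1%:R / n.+1%:R) *
    overlap c e ((s i)%:R / n.+1%:R) ((s i).+1%:R / n.+1%:R))%:E.
Proof.
rewrite /perm_measure EFinM -sumEFin; congr (_ * _)%E.
apply: eq_bigr => i _; rewrite /perm_cell -setXI.
by rewrite product_measure1E ?EFinM -?lebesgue_overlap//; exact: measurableI.
Qed.

Let overlap01 (i : 'I_n.+1) :
  overlap 0 1 (i%:R / n.+1%:R) (i.+1%:R / n.+1%:R) = n.+1%:R^-1 :> R.
Proof.
have i0 : 0 <= i%:R / n.+1%:R :> R by rewrite divr_ge0.
have ii : i%:R / n.+1%:R <= i.+1%:R / n.+1%:R :> R.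
  by rewrite ler_pM2r ?invr_gt0 ?ltr0n// ler_nat.
have i1 : i.+1%:R / n.+1%:R <= 1 :> R.
  by rewrite ler_pdivrMr ?ltr0n// mul1r ler_nat.
by rewrite overlapC overlap_sub// -mulrBl -natrB// subSnn mul1r.
Qed.

Lemma perm_measure_marginals : uniform_marginals perm_measure.
Proof.
move=> a b a0 ab b1; rewrite !perm_measure_rect.
have N0 : n.+1%:R != 0 :> R by rewrite pnatr_eq0.
split; congr EFin.
  under eq_bigr do rewrite overlap01.
  by rewrite -mulr_sumr mulVKf// -(sum_overlap n a0 ab b1) [RHS](reindex_perm s).
under eq_bigr do rewrite overlap01.
by rewrite -mulr_suml mulrCA divff// mulr1 sum_overlap.
Qed.

Let perm_measure_setT : perm_measure setT = 1%E.
Proof.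
have [+ _] := perm_measure_marginals (lexx 0) (@ler01 R) (lexx 1).
rewrite subr0 => <-; rewrite /perm_measure; congr (_ * _)%E.
apply: eq_bigr => i _; congr ((_ \x _)%E _).
apply/seteqP; split=> [[x y] [_ cxy]|[x y] [_ cxy]]; split=> //.
case: cxy => /=; rewrite !in_itv/= => /andP[x0 x1] /andP[y0 y1].
have H (j : 'I_n.+1) (u : R) : j%:R / n.+1%:R <= u -> u <= j.+1%:R / n.+1%:R ->
    0 <= u <= 1.
  move=> ju uj; rewrite (le_trans _ ju) ?divr_ge0//=.
  by rewrite (le_trans uj)// ler_pdivrMr ?ltr0n// mul1r ler_nat.
by split; [exact: H x0 x1|exact: H y0 y1].
Qed.

HB.instance Definition _ := Measure_isProbability.Build _ _ _ perm_measure
  perm_measure_setT.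

Definition perm_permuton : permuton R := Permuton perm_measure_marginals.

End PermMeasure.

HB.instance Definition _ (R : realType) :=
  isPointed.Build (permuton R) (perm_permuton R (1%g : 'S_1)).

Section RectangleMeasure.
Variable R : realType.
Local Notation leb := (@lebesgue_measure R).

Definition segment (p q : R * R) : set (plane R) :=
  [set ((1 - t) * p.1 + t * q.1, (1 - t) * p.2 + t * q.2) | t in `[0, 1]].

(** [fst] is injective on the [L] of interest, so that Borel sets have Borel
    images. *)
Definition segment_measure (L S : set (plane R)) : \bar R :=
  ((2^-1)%:E * leb (fst @` (S `&` L)))%E.

Let graph (c e x : R) : R * R := (x, c + e * x).

Let fst_segment (a b c e : R) (S : set (plane R)) : a <= b ->
  fst @` (S `&` segment (graph c e a) (graph c e b)) =
  graph c e @^-1` S `&` `[a, b].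
Proof.
move=> ab; apply/seteqP; split=> x /=.
  move=> [[u v] [Suv [t]]]; rewrite /= !in_itv/= => /andP[t0 t1] [uE vE] <-/=.
  split; last by rewrite -uE; nra.
  rewrite /graph -[X in S X]/(u, c + e * u).
  by have -> : c + e * u = v by rewrite -uE -vE; ring.
rewrite in_itv/= => -[Sx /andP[ax xb]].
exists (graph c e x) => //; split=> //.
have [ab0|ab0] := eqVneq a b.
  have xa : x = a by lra.
  exists 0; first by rewrite /= in_itv/= lexx ler01.
  by rewrite /graph /= xa; congr (_, _); ring.
have ba : 0 < b - a by rewrite subr_gt0 lt_neqAle ab0.
have xE : x = (1 - (x - a) / (b - a)) * a + (x - a) / (b - a) * b.
  by field; rewrite gt_eqF.
exists ((x - a) / (b - a)).
  rewrite /= in_itv/= divr_ge0 ?subr_ge0//=.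
  by rewrite ler_pdivrMr// mul1r lerD2r.
rewrite /graph /= -xE; congr (_, _).
by rewrite [in RHS]xE; ring.
Qed.

Let mgraph c e : 
  measurable_fun setT (graph c e : measurableTypeR R -> plane R).
Proof.
apply: measurable_fun_pair => //.
by apply: measurable_funD => //; exact: measurable_funM.
Qed.

Let mitv (a b : R) : measurable (`[a, b] : set (measurableTypeR R)).
Proof. exact: measurable_itv. Qed.

Let half_ge0 : 0 <= 2^-1 :> R.
Proof. by rewrite invr_ge0. Qed.

Let graph_measure (a b c e : R) : {measure set (plane R) -> \bar R}.
Proof.
refine (mscale (NngNum half_ge0)
  (pushforward (mrestr leb (mitv a b))
    (graph c e : measurableTypeR R -> plane R))).
exact: mgraph.
Defined.

Let segment_measureE (a b y0 y1 c e : R) (S : set (plane R)) : a <= b ->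
  y0 = c + e * a -> y1 = c + e * b ->
  segment_measure (segment (a, y0) (b, y1)) S = graph_measure a b c e S.
Proof. by move=> ab -> ->; rewrite /segment_measure fst_segment. Qed.

Let segment_measure_overlap (a b u v y0 y1 c e : R) (S : set (plane R)) :
  u <= v -> y0 = c + e * u -> y1 = c + e * v ->
  (forall x, u <= x <= v -> S (graph c e x) <-> a <= x <= b) ->
  segment_measure (segment (u, y0) (v, y1)) S = (2^-1 * overlap a b u v)%:E.
Proof.
move=> uv -> -> H; rewrite /segment_measure fst_segment// EFinM.
rewrite -lebesgue_overlap; congr (_ * leb _)%E.
apply/seteqP; split=> x /= [Sx]; rewrite in_itv/= => uxv.
  by split=> //; rewrite in_itv/=; apply/H.
by split=> //; apply/H.
Qed.

Let segment_sub p q : unit_square p -> unit_square q ->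
  segment p q `<=` unit_square (R := R).
Proof.
move=> [/= + +] [/= + +] _ [t /= + <-]; rewrite /unit_square /= !in_itv/=.
move=> /andP[? ?] /andP[? ?] /andP[? ?] /andP[? ?] /andP[? ?].
by split; apply/andP; split; nra.
Qed.

Definition side1 (z : R) := segment (0, z) (z, 0).
Definition side2 (z : R) := segment (0, z) (1 - z, 1).
Definition side3 (z : R) := segment (z, 0) (1, 1 - z).
Definition side4 (z : R) := segment (1 - z, 1) (1, 1 - z).

Variable z : R.
Hypothesis z01 : 0 <= z <= 1.

(** [z01] plays no role in the formula; it is an argument because the formula
    defines a measure with uniform marginals only for such [z]. *)
Definition rectangle_measure (z01 : 0 <= z <= 1) (S : set (plane R)) : \bar R :=
  (segment_measure (side1 z) S + segment_measure (side2 z) S +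
   segment_measure (side3 z) S + segment_measure (side4 z) S)%E.

Local Notation mu := (rectangle_measure z01).

Let rectangle_measureE S : mu S =
  measure_add (measure_add (measure_add
    (graph_measure 0 z z (-1)) (graph_measure 0 (1 - z) z 1))
    (graph_measure z 1 (- z) 1)) (graph_measure (1 - z) 1 (2 - z) (-1)) S.
Proof.
have /andP[z0 z1] := z01.
rewrite /rectangle_measure /side1 /side2 /side3 /side4.
rewrite (@segment_measureE _ _ _ _ z (-1)); [|lra..].
rewrite (@segment_measureE _ _ _ _ z 1); [|lra..].
rewrite (@segment_measureE _ _ _ _ (- z) 1); [|lra..].
rewrite (@segment_measureE _ _ _ _ (2 - z) (-1)); [|lra..].
rewrite measure_addE; apply: (f_equal2 adde) => //.
rewrite [RHS]measure_addE; apply: (f_equal2 adde) => //.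
by rewrite [RHS]measure_addE.
Qed.

Let rectangle_measure0 : mu set0 = 0%E.
Proof. by rewrite rectangle_measureE; exact: measure0. Qed.

Let rectangle_measure_ge0 S : (0 <= mu S)%E.
Proof. by rewrite rectangle_measureE; exact: measure_ge0. Qed.

Let rectangle_measure_sigma_additive : semi_sigma_additive mu.
Proof. by apply: eq_semi_sigma_additive => A _; exact: rectangle_measureE. Qed.

HB.instance Definition _ := isMeasure.Build _ _ _ mu
  rectangle_measure0 rectangle_measure_ge0 rectangle_measure_sigma_additive.

Lemma rectangle_measure_marginals : uniform_marginals mu.
Proof.
have /andP[z0 z1] := z01.
move=> a b a0 ab b1.
have ab01 : overlap a b 0 1 = b - a by exact: overlap_sub.
have cat1 : overlap a b 0 z + overlap a b z 1 = b - a by rewrite overlap_cat.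
have cat2 : overlap a b 0 (1 - z) + overlap a b (1 - z) 1 = b - a.
  by rewrite overlap_cat//; lra.
split; rewrite /rectangle_measure /side1 /side2 /side3 /side4.
- rewrite (@segment_measure_overlap (z - b) (z - a) _ _ _ _ z (-1)); [|try lra..];
    last first.
    move=> x xz; rewrite /graph /= !in_itv/=; split; last by split; lra.
    by move=> [? ?]; lra.
  rewrite (@segment_measure_overlap (a - z) (b - z) _ _ _ _ z 1); [|try lra..];
    last first.
    move=> x xz; rewrite /graph /= !in_itv/=; split; last by split; lra.
    by move=> [? ?]; lra.
  rewrite (@segment_measure_overlap (a - - z) (b - - z) _ _ _ _ (- z) 1);
    [|try lra..]; last first.
    move=> x xz; rewrite /graph /= !in_itv/=; split; last by split; lra.
    by move=> [? ?]; lra.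
  rewrite (@segment_measure_overlap (2 - z - b) (2 - z - a) _ _ _ _ (2 - z) (-1));
    [|try lra..]; last first.
    move=> x xz; rewrite /graph /= !in_itv/=; split; last by split; lra.
    by move=> [? ?]; lra.
  rewrite !overlap_shift !overlap_refl -!EFinD; congr EFin.
  have -> : z - z = 0 by ring.
  have -> : z - 0 = z by ring.
  have -> : 0 + z = z by ring.
  have -> : 1 - z + z = 1 by ring.
  have -> : 2 - z - 1 = 1 - z by ring.
  have -> : 2 - z - (1 - z) = 1 by ring.
  by move: cat1 cat2; lra.
- rewrite (@segment_measure_overlap a b _ _ _ _ z (-1)); [|try lra..];
    last first.
    move=> x xz; rewrite /graph /= !in_itv/=; split; last by split; lra.
    by move=> [? ?]; lra.
  rewrite (@segment_measure_overlap a b _ _ _ _ z 1); [|try lra..];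
    last first.
    move=> x xz; rewrite /graph /= !in_itv/=; split; last by split; lra.
    by move=> [? ?]; lra.
  rewrite (@segment_measure_overlap a b _ _ _ _ (- z) 1); [|try lra..];
    last first.
    move=> x xz; rewrite /graph /= !in_itv/=; split; last by split; lra.
    by move=> [? ?]; lra.
  rewrite (@segment_measure_overlap a b _ _ _ _ (2 - z) (-1)); [|try lra..];
    last first.
    move=> x xz; rewrite /graph /= !in_itv/=; split; last by split; lra.
    by move=> [? ?]; lra.
  rewrite -!EFinD; congr EFin.
  by move: cat1 cat2; lra.
Qed.

Let rectangle_measure_setT : mu setT = 1%E.
Proof.
have /andP[z0 z1] := z01.
have [+ _] := rectangle_measure_marginals (lexx 0) (@ler01 R) (lexx 1).
rewrite subr0 => <-; rewrite /rectangle_measure /side1 /side2 /side3 /side4 /segment_measure.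
have H (a b c e : R) : 0 <= a <= 1 -> 0 <= b <= 1 -> 0 <= c <= 1 ->
    0 <= e <= 1 -> setT `&` segment (a, b) (c, e) =
    `[0, 1] `*` `[0, 1] `&` segment (a, b) (c, e).
  by move=> *; rewrite setTI setIidr//; apply: segment_sub.
by rewrite !H// ?lexx ?ler01 ?z0 ?z1 ?subr_ge0 ?gerBl ?z0 ?z1.
Qed.

HB.instance Definition _ := Measure_isProbability.Build _ _ _ mu
  rectangle_measure_setT.

Definition rectangle_permuton : permuton R :=
  Permuton rectangle_measure_marginals.

End RectangleMeasure.

(* Main.v *)
(** Fix the position z of the value 1 of a square permutation of size n.  Label
    each position by whether its point is a lower record (left-to-right or
    right-to-left minimum) and each value by whether its point is a left record
    (left-to-right minimum or maximum).  These two binary words of length n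
    determine the permutation, and five of their letters are forced, so at most
    2^(2n-5) square permutations share a given inner z.  Conversely, if both
    words have balanced prefixes, as all but a vanishing proportion have by a
    fourth moment bound, and z is not too close to 1 or n, then matching the
    letters in order gives a square permutation with these labels, and all its
    points lie close to the sides of the rectangle with parameter z/n.  Hence
    the square permutations of size n are asymptotically equidistributed over z, and
    almost all of them are close to a rectangle; the balance between lower and
    upper records, tested against a given continuous function by Chebyshev's
    inequality, puts mass 1/2 dx on the lower and on the upper sides.  Since the
    rectangle permutons form a compact curve, a continuous function of the
    permuton is controlled near that curve by finitely many test integrals,
    uniformly in z. *)

Require Import Defs.
From Stdlib Require List.
From mathcomp Require Import all_boot all_order all_algebra all_fingroup.
From mathcomp Require Import all_classical all_reals all_analysis.
From mathcomp Require Import measurable_realfun zify ring lra.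

Set Implicit Arguments.
Unset Strict Implicit.
Unset Printing Implicit Defensive.

(** * Records and words *)

(** The forced letters are those of the first, the last and the minimal position, always lower
    records, and those of the smallest and the largest value, always left records. Injectivity of
    the code bounds the number of permutations with a given [z] from above, decoding bounds it from
    below, and the bounds agree up to a factor tending to [1]; the size of [Sq n.+1] is then the
    case of a constant function. Balance concerns all prefixes at once, with an imbalance [a] of a
    small multiple of [n]. The union over the prefixes costs a factor [n]: second moments, of order
    [n / a ^ 2] per prefix, would leave a constant, while fourth moments, of order [n ^ 2 / a ^ 4],
    leave [O(1 / n)]. For [z] near the ends only a crude upper bound is used, on a proportion of
    positions that can be chosen small. The function to integrate is an arbitrary continuous one,
    and its neighbourhoods at different points of the curve involve different test functions.
    Compactness yields one finite family for the whole curve, so that only finitely many small sets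
    of exceptional permutations add up. *)

Section Code.
Variable n : nat.
Implicit Types (s t : 'S_n.+1) (i j p q : 'I_n.+1).

(** A point may be a record of several types; lower wins over upper and left over right. Hence in a
    square permutation a point that is not [low] is an upper record, and one that is not [left] a
    right record. *)
Definition low s i := lr_min s i || rl_min s i.
Definition left s i := lr_min s i || lr_max s i.
Definition argmin s : 'I_n.+1 := (s^-1)%g ord0.

Lemma lr_maxP s i : reflect (forall j, j < i -> s j < s i) (lr_max s i).
Proof. by apply: (iffP forallP) => H j; [apply/implyP|apply/implyP/H]. Qed.
Lemma lr_minP s i : reflect (forall j, j < i -> s i < s j) (lr_min s i).
Proof. by apply: (iffP forallP) => H j; [apply/implyP|apply/implyP/H]. Qed.
Lemma rl_maxP s i : reflect (forall j, i < j -> s j < s i) (rl_max s i).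
Proof. by apply: (iffP forallP) => H j; [apply/implyP|apply/implyP/H]. Qed.
Lemma rl_minP s i : reflect (forall j, i < j -> s i < s j) (rl_min s i).
Proof. by apply: (iffP forallP) => H j; [apply/implyP|apply/implyP/H]. Qed.

Lemma argminP s : s (argmin s) = ord0.
Proof. by rewrite permKV. Qed.

Lemma lr_min_le_argmin s i : lr_min s i -> i <= argmin s.
Proof.
move=> /lr_minP H; rewrite leqNgt; apply/negP => /H.
by rewrite argminP.
Qed.

Lemma rl_min_ge_argmin s i : rl_min s i -> argmin s <= i.
Proof.
move=> /rl_minP H; rewrite leqNgt; apply/negP => /H.
by rewrite argminP.
Qed.

(** Up to the minimum, the only possible right-to-left minimum is the minimum itself, which is also
    a left-to-right minimum. So [argmin] and [low] together determine the type of a lower record. *)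
Lemma low_le_argmin s i : i <= argmin s -> low s i -> lr_min s i.
Proof.
move=> iz /orP[//|ri]; have zi := rl_min_ge_argmin ri.
have -> : i = argmin s by apply/val_inj/eqP; rewrite eqn_leq iz zi.
apply/lr_minP => j jz; rewrite argminP lt0n.
by apply/eqP => sj0; move: jz; rewrite -(permK s j) (_ : s j = ord0) ?ltnn//;
  apply/val_inj.
Qed.

Lemma low_ge_argmin s i : argmin s <= i -> low s i -> rl_min s i.
Proof.
move=> zi /orP[ri|//]; have iz := lr_min_le_argmin ri.
have -> : i = argmin s by apply/val_inj/eqP; rewrite eqn_leq iz zi.
apply/rl_minP => j jz; rewrite argminP lt0n.
by apply/eqP => sj0; move: jz; rewrite -(permK s j) (_ : s j = ord0) ?ltnn//;
  apply/val_inj.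
Qed.

(** Strong induction on the value [j]: once the two permutations agree on the
    smaller values, the labels make the position of [j] an extreme one among the
    free positions, or among the free low ones, in both of them. *)
Lemma code_inj s t : is_square s -> is_square t -> argmin s = argmin t ->
  low s =1 low t -> (forall j, left s (s^-1 j)%g = left t (t^-1 j)%g) -> s = t.
Proof.
move=> sqs sqt zE lowE leftE.
suff H j : (s^-1)%g j = (t^-1)%g j.
  by apply: invg_inj; apply/permP.
have [k] := ubnP (j : nat); elim: k j => // k IH j; rewrite ltnS => jk.
have {}IH i : i < j -> (s^-1)%g i = (t^-1)%g i by move=> ij; apply: IH; lia.
set p := (s^-1)%g j; set q := (t^-1)%g j.
have sp : s p = j by rewrite permKV.
have tq : t q = j by rewrite permKV.
have tr i : s i < j -> t i < j.
  by move=> sij; have := IH _ sij; rewrite permK => ->; rewrite permKV.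
have rt i : t i < j -> s i < j.
  by move=> sij; have := IH _ sij; rewrite permK => <-; rewrite permKV.
have {}leftE : left s p = left t q := leftE j.
have cmp (P : Prop) : (p < q -> False) -> (q < p -> False) -> p = q.
  by move=> pq qp; apply: val_inj => /=; apply/eqP; rewrite eqn_leq; apply/andP;
    split;
    rewrite leqNgt; apply/negP.
(* A left-to-right minimum of value [j] in one permutation cannot face a left-to-right maximum in
   the other: the maximum puts the first position among the values below [j], where both agree, and
   the minimum forbids this. [mixR] is the mirror image, with the last position. *)
have mixL (s1 t1 : 'S_n.+1) p1 q1 : s1 p1 = j -> t1 q1 = j ->
    (forall i, t1 i < j -> s1 i < j) -> lr_min s1 p1 -> ~~ lr_min t1 q1 ->
    lr_max t1 q1 -> False.
  move=> sp1 tq1 rt1 /lr_minP lm nlm /lr_maxP lM.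
  have q0 : (ord0 : 'I_n.+1) < q1.
    rewrite lt0n; apply: contraNneq nlm => q0; apply/lr_minP => i; lia.
  have := rt1 _ (_ : t1 ord0 < j); rewrite -{1}tq1 => /(_ (lM _ q0)).
  have [p0|p0] := posnP p1.
    by rewrite -sp1 (_ : p1 = ord0) ?ltnn//; apply/val_inj.
  by have := lm ord0 p0; rewrite sp1; lia.
have mixR (s1 t1 : 'S_n.+1) p1 q1 : s1 p1 = j -> t1 q1 = j ->
    (forall i, t1 i < j -> s1 i < j) -> rl_min s1 p1 -> ~~ rl_min t1 q1 ->
    rl_max t1 q1 -> False.
  move=> sp1 tq1 rt1 /rl_minP lm nlm /rl_maxP lM.
  have q0 : q1 < (ord_max : 'I_n.+1).
    have := ltn_ord q1; rewrite ltnS leq_eqVlt => /predU1P[q0|//].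
    by case/negP: nlm; apply/rl_minP => i; have := ltn_ord i; rewrite q0; lia.
  have := rt1 _ (_ : t1 ord_max < j); rewrite -{1}tq1 => /(_ (lM _ q0)).
  have [p0|p0] := leqP n p1.
    rewrite -sp1 (_ : p1 = ord_max) ?ltnn//; apply/val_inj => /=.
    by have := ltn_ord p1; lia.
  by have := lm ord_max p0; rewrite sp1; lia.
have [Ls|Rs] := boolP (left s p).
  have Lt : left t q by rewrite -leftE.
  have [ms|ms] := boolP (lr_min s p); have [mt|mt] := boolP (lr_min t q).
  - apply: (cmp True) => pq.
      have : lr_min s q.
        by apply: low_le_argmin; [rewrite zE lr_min_le_argmin|rewrite lowE /low
          mt].
      by move=> /lr_minP/(_ _ pq); rewrite sp => /tr; rewrite tq ltnn.
    have : lr_min t p.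
      by apply: low_le_argmin; [rewrite -zE lr_min_le_argmin|rewrite -lowE /low
        ms].
    by move=> /lr_minP/(_ _ pq); rewrite tq => /rt; rewrite sp ltnn.
  - by case: (mixL s t p q sp tq rt ms mt); move: Lt; rewrite /left (negPf mt).
  - by case: (mixL t s q p tq sp tr mt ms); move: Ls; rewrite /left (negPf ms).
  - move: Ls Lt; rewrite /left (negPf ms) (negPf mt)/= =>
    /lr_maxP Ms /lr_maxP Mt.
    apply: (cmp True) => pq.
      by have := Mt _ pq; rewrite tq => /rt; rewrite sp ltnn.
    by have := Ms _ pq; rewrite sp => /tr; rewrite tq ltnn.
have Rt : ~~ left t q by rewrite -leftE.
have recs : rl_min s p || rl_max s p.
  move/forallP: sqs => /(_ p); move: Rs; rewrite /left /is_record negb_or =>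
    /andP[/negPf-> /negPf->] /=.
  by rewrite orbC.
have rect : rl_min t q || rl_max t q.
  move/forallP: sqt => /(_ q); move: Rt; rewrite /left /is_record negb_or =>
    /andP[/negPf-> /negPf->] /=.
  by rewrite orbC.
have [ms|ms] := boolP (rl_min s p); have [mt|mt] := boolP (rl_min t q).
- apply: (cmp True) => pq.
    have : rl_min t p.
      by apply: low_ge_argmin; [rewrite -zE rl_min_ge_argmin|rewrite -lowE /low
        ms orbT].
    by move=> /rl_minP/(_ _ pq); rewrite tq => /rt; rewrite sp ltnn.
  have : rl_min s q.
    by apply: low_ge_argmin; [rewrite zE rl_min_ge_argmin|rewrite lowE /low mt
      orbT].
  by move=> /rl_minP/(_ _ pq); rewrite sp => /tr; rewrite tq ltnn.
- by case: (mixR s t p q sp tq rt ms mt); move: rect; rewrite (negPf mt).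
- by case: (mixR t s q p tq sp tr mt ms); move: recs; rewrite (negPf ms).
- move: recs rect; rewrite (negPf ms) (negPf mt)/= => /rl_maxP Ms /rl_maxP Mt.
  apply: (cmp True) => pq.
    by have := Ms _ pq; rewrite sp => /tr; rewrite tq ltnn.
  by have := Mt _ pq; rewrite tq => /rt; rewrite sp ltnn.
Qed.
End Code.

(** * Decoding balanced words *)

Section Count.
Implicit Types (p : pred nat) (t u k N : nat).

Definition cnt p t := \sum_(i < t) (p i : nat).

Lemma cntS p t : cnt p t.+1 = cnt p t + p t.
Proof. by rewrite /cnt big_ord_recr. Qed.

Lemma leq_cnt p t u : t <= u -> cnt p t <= cnt p u.
Proof.
elim: u => [|u IH]; first by rewrite leqn0 => /eqP ->.
by rewrite leq_eqVlt => /predU1P[->//|]; rewrite ltnS => /IH; rewrite cntS; lia.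
Qed.

Lemma ltn_cnt p t u : p t -> t < u -> cnt p t < cnt p u.
Proof. by move=> pt /(leq_cnt p); rewrite cntS pt; lia. Qed.

Lemma cnt_ltn p t u : cnt p t < cnt p u -> t < u.
Proof. by rewrite !ltnNge; apply: contra; exact: leq_cnt. Qed.

Lemma cnt_inj p t u : p t -> p u -> cnt p t = cnt p u -> t = u.
Proof.
by move=> pt pu E; case: (ltngtP t u) => // [/(ltn_cnt pt)|/(ltn_cnt pu)]; lia.
Qed.

Lemma cnt_select p N k : k < cnt p N -> exists v, [/\ v < N, p v & cnt p v = k].
Proof.
elim: N => [|N IH]; first by rewrite /cnt big_ord0.
have [kN _|kN] := ltnP k (cnt p N).
  by have [v [vN pv <-]] := IH kN; exists v; split=> //; lia.
rewrite cntS; case pN : (p N) => kN'; last lia.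
by exists N; split=> //; lia.
Qed.

Lemma cntC p t : cnt p t + cnt (predC p) t = t.
Proof.
elim: t => [|t IH]; first by rewrite /cnt !big_ord0.
by rewrite !cntS /=; case: (p t) => /=; lia.
Qed.

(** Every prefix count is within [a / 2] of half the length; doubling keeps this in the naturals. *)
Definition balanced a p N := forall t, t <= N ->
  t <= (cnt p t).*2 + a /\ (cnt p t).*2 <= t + a.

End Count.

Section Decode.
Variables (X Y : pred nat) (n z a : nat).
Local Notation N := n.+1.
Hypotheses (bX : balanced a X N) (bY : balanced a Y N).
Hypotheses (az : 6 * a + 12 < z) (azN : 6 * a + 12 < N - z).

(** The four cases are the left-to-right minima, the right-to-left minima, the
    left-to-right maxima and the right-to-left maxima.  The low positions are
    read from [z] outwards, the high ones from both ends inwards, and the [k]-th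
    position of a branch is matched with the [k]-th value upwards in the
    corresponding part of the left, resp. right, values. *)
Definition decodes i v : Prop :=
  if X i then
    if i <= z then Y v /\ cnt Y v + cnt X i.+1 = cnt X z.+1
    else ~~ Y v /\ cnt (predC Y) v + cnt X z.+1 = cnt X i
  else if cnt (predC X) i + cnt X z.+1 < cnt Y N then
    Y v /\ cnt Y v = cnt X z.+1 + cnt (predC X) i
  else ~~ Y v /\
    cnt (predC Y) v + cnt (predC X) i.+1 + cnt X z.+1 =
      cnt X N + cnt (predC X) N.

Let zN : z < N. Proof. lia. Qed.

(** Balance and the margins on [z] guarantee enough left and right values for the low points; the
    high points go left exactly until the left values run out. *)
Lemma decodes_ex i : i < N -> exists v, v < N /\ decodes i v.
Proof.
move=> iN; rewrite /decodes.
have [? ?] := bX zN; have [? ?] := bY (leqnn N); have [? ?] := bX (leqnn N).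
have := cntC X N; have := cntC Y N; move=> ? ?.
have mX := leq_cnt X; have mX' := leq_cnt (predC X).
case Xi: (X i).
  have [iz|iz] := leqP i z.
    have [|v [vN Yv cv]] := @cnt_select Y N (cnt X z.+1 - cnt X i.+1).
      lia.
    exists v; split=> //; split=> //.
    by have := mX i.+1 z.+1 iz; lia.
  have [|v [vN Yv cv]] := @cnt_select (predC Y) N (cnt X i - cnt X z.+1).
    by have := mX _ _ (ltnW iN); lia.
  by exists v; split=> //; split=> //; have := mX z.+1 i iz; lia.
have [ci|ci] := ltnP (cnt (predC X) i + cnt X z.+1) (cnt Y N).
  have [|v [vN Yv cv]] := @cnt_select Y N (cnt X z.+1 + cnt (predC X) i);
    first lia.
  by exists v.
have H1 := mX' _ _ iN; have H2 := mX _ _ zN; have H3 := cntS (predC X) i.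
have [|v [vN Yv cv]] := @cnt_select (predC Y) N
    (cnt X N + cnt (predC X) N - cnt X z.+1 - cnt (predC X) i.+1).
  by move: H3; rewrite /= Xi /=; lia.
by exists v; split=> //; split=> //; lia.
Qed.

(** The letter at [v] separates the left branches from the right ones; on either side the low branch
    takes the smaller value counts and the high branch the remaining ones. *)
Lemma decodes_inj i i' v : i < N -> i' < N -> decodes i v -> decodes i' v ->
    i = i'.
Proof using az azN.
wlog ii' : i i' / i < i'.
  move=> W iN i'N d d'; case: (ltngtP i i') => // ii'; first exact: W.
  by apply/esym; exact: W.
move=> iN i'N; rewrite /decodes.
have H1 := leq_cnt X ii'; have H1' := leq_cnt (predC X) ii'.
have H2 := leq_cnt X i'N; have H2' := leq_cnt (predC X) i'N.
have SX j : cnt X j.+1 = cnt X j + X j by rewrite cntS.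
have SX' j : cnt (predC X) j.+1 = cnt (predC X) j + ~~ X j by rewrite cntS.
have H3 : i' <= z -> cnt X i'.+1 <= cnt X z.+1 by move=> ?; exact: leq_cnt.
have H4 : i <= z -> cnt X i.+1 <= cnt X z.+1 by move=> ?; exact: leq_cnt.
have H5 : z < i' -> cnt X z.+1 <= cnt X i' by move=> ?; exact: leq_cnt.
have H6 : z < i -> cnt X z.+1 <= cnt X i by move=> ?; exact: leq_cnt.
have H7 := cntC Y N.
have H8 := cntC X N.
move: (SX i) (SX i') (SX' i) (SX' i').
case: (X i) => /=; case: (X i') => /=;
  repeat (case: ifP => /= ?); case: (Y v) => // ? ? ? ? [? ?] [? ?] //; try lia.
Qed.

Section Bounds.
Variables (i v : nat).
Hypotheses (iN : i < N) (vN : v < N).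
Hypothesis d : decodes i v.

Ltac facts :=
  have [? ?] := bX (ltnW iN); have [? ?] := bX iN; have [? ?] := bX zN;
  have [? ?] := bX (leqnn N); have [? ?] := bY (ltnW vN);
    have [? ?] := bY (leqnn N);
  have ? := cntC X i; have ? := cntC X i.+1; have ? := cntC X z.+1;
  have ? := cntC X N; have ? := cntC Y v; have ? := cntC Y N.

(** Every matching equation involves three prefix counts, each of which, doubled, is the prefix
    length up to [a]: whence [3 * a], and [3] for the shifts by one. The same holds for the other
    branches, where letters of both kinds together are counted exactly. *)
Lemma decodes_low_left : X i -> i <= z ->
  [/\ Y v, v + i <= z + 3 * a + 3 & z <= v + i + 3 * a + 3].
Proof.
facts; move: d; rewrite /decodes => + Xi iz.
by rewrite Xi iz => -[Yv cv]; split=> //; lia.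
Qed.

Lemma decodes_low_right : X i -> z < i ->
  [/\ ~~ Y v, v + z <= i + 3 * a + 3 & i <= v + z + 3 * a + 3].
Proof.
facts; move: d; rewrite /decodes => + Xi iz.
by rewrite Xi leqNgt iz => -[Yv cv]; split=> //; lia.
Qed.

Lemma decodes_high_left : ~~ X i -> Y v ->
  [/\ cnt (predC X) i + cnt X z.+1 < cnt Y N,
      cnt Y v = cnt X z.+1 + cnt (predC X) i,
      v <= z + i + 3 * a + 3 & z + i <= v + 3 * a + 3].
Proof.
facts; move: d; rewrite /decodes => + /negPf Xi Yv.
by rewrite Xi Yv; case: ifP => [H|_] [//] _ cv; split=> //; lia.
Qed.

Lemma decodes_high_right : ~~ X i -> ~~ Y v ->
  [/\ cnt Y N <= cnt (predC X) i + cnt X z.+1,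
      cnt (predC Y) v + cnt (predC X) i.+1 + cnt X z.+1 =
        cnt X N + cnt (predC X) N,
      v + z + i <= 2 * N + 3 * a + 3 & 2 * N <= v + z + i + 3 * a + 3].
Proof.
facts; move: d; rewrite /decodes => + /negPf Xi Yv.
by rewrite Xi (negPf Yv); case: ifP => [_|/negbT H] [//] _ cv; split=> //; lia.
Qed.

End Bounds.

End Decode.

Ltac natlia := repeat match goal with
  | H : is_true ?b |- _ => lazymatch b with leq _ _ => fail | _ => clear H end
  end; lia.

(** * The square permutation decoded from two balanced words *)

Section Realize.
Variable n : nat.
Implicit Types (x y : {ffun 'I_n.+1 -> bool}) (s : 'S_n.+1) (z i j : 'I_n.+1).

(** Beyond [n], [inord] falls back to [0]; prefixes of length at most [n.+1] do not see this. *)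
Definition onat x : pred nat := fun k => x (inord k).

Lemma onatE x i : onat x i = x i.
Proof. by rewrite /onat inord_val. Qed.

(** By truncated subtraction [(i - z) + (z - i)] is the distance of [i] and [z],
    so [s i] is within [e] of [|i - z|] or of [n.+1 - |i + z - n.+1|]. *)
Definition near_sides (e : nat) s z := forall i : 'I_n.+1,
  if low s i then s i <= (i - z) + (z - i) + e /\ (i - z) + (z - i) <= s i + e
  else s i + ((i + z - n.+1) + (n.+1 - (i + z))) <= n.+1 + e /\
       n.+1 <= s i + ((i + z - n.+1) + (n.+1 - (i + z))) + e.

Lemma card_ord_lt k : k <= n.+1 -> #|[set i : 'I_n.+1 | i < k]| = k.
Proof.
move=> kn; rewrite cardsE -sum1_card.
by rewrite -(big_ord_widen _ (fun=> 1%N) kn) sum1_card card_ord.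
Qed.

(** The [i] earlier points have values below [s i], so there are at least [i] such values. This and
    the next two bounds keep a type of record on one side of a diagonal, which later excludes that
    type for points near the opposite sides of the rectangle. *)
Lemma lr_max_le s i : lr_max s i -> i <= s i.
Proof.
move=> /lr_maxP H; rewrite -[leqLHS](card_ord_lt (ltnW (ltn_ord i))).
rewrite -(card_imset _ (@perm_inj _ s)) -[leqRHS](card_ord_lt (ltnW (ltn_ord (s
  i)))).
apply: subset_leq_card; apply/fintype.subsetP => _ /imsetP[j /[!inE] ji ->].
exact: H.
Qed.

Lemma rl_min_le s i : rl_min s i -> s i <= i.
Proof.
move=> /rl_minP H; rewrite -[leqRHS](card_ord_lt (ltnW (ltn_ord i))).
rewrite -[leqRHS](card_imset _ (@perm_inj _ s)) -[leqLHS](card_ord_lt (ltnW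
  (ltn_ord (s i)))).
apply: subset_leq_card; apply/fintype.subsetP => v /[!inE] vi.
apply/imsetP; exists (s^-1 v)%g; rewrite ?permKV// inE ltnNge leq_eqVlt.
apply/negP => /predU1P[/val_inj E|/H]; last by rewrite permKV; lia.
by move: vi; rewrite E permKV ltnn.
Qed.

Lemma lr_min_le s i : lr_min s i -> s i + i <= n.
Proof.
move=> /lr_minP H; have := ltn_ord (s i); have := ltn_ord i => ni nsi.
suff: i <= n.+1 - (s i).+1 by lia.
rewrite -[leqLHS](card_ord_lt (ltnW (ltn_ord i))).
have -> : n.+1 - (s i).+1 = #|~: [set v : 'I_n.+1 | v < (s i).+1]|.
  by rewrite cardsCs finset.setCK card_ord_lt// card_ord.
rewrite -(card_imset _ (@perm_inj _ s)); apply: subset_leq_card.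
apply/fintype.subsetP => _ /imsetP[j /[!inE] ji ->]; rewrite ltnS -ltnNge.
exact: H.
Qed.

Section Build.
Variables (x y : {ffun 'I_n.+1 -> bool}) (z : 'I_n.+1) (a : nat).
Hypotheses (x0 : x ord0) (xn : x ord_max) (xz : x z).
Hypotheses (y0 : y ord0) (yn : y ord_max).
Hypotheses (bx : balanced a (onat x) n.+1) (by_ : balanced a (onat y) n.+1).
Hypotheses (az : 6 * a + 12 < z) (azN : 6 * a + 12 < n.+1 - z).

Local Notation X := (onat x).
Local Notation Y := (onat y).
Local Notation dec := (decodes X Y n z).

Let xE i : X i = x i. Proof. exact: onatE. Qed.
Let yE i : Y i = y i. Proof. exact: onatE. Qed.
Let X0 : X 0. Proof. by rewrite (xE ord0). Qed.
Let Y0 : Y 0. Proof. by rewrite (yE ord0). Qed.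
Let Xn : X n. Proof. by rewrite (xE ord_max). Qed.
Let Yn : Y n. Proof. by rewrite (yE ord_max). Qed.

Lemma decode_perm : exists s : 'S_n.+1, forall i, dec i (s i).
Proof.
have H (i : 'I_n.+1) : exists v : 'I_n.+1, dec i v.
  have [v [vN dv]] := decodes_ex bx by_ az azN (ltn_ord i).
  by exists (Ordinal vN).
have [f Hf] := fin_all_exists H.
have injf : injective f.
  move=> i i' E; apply: val_inj; have := Hf i'; rewrite -E.
  exact: (decodes_inj az azN (ltn_ord i) (ltn_ord i') (Hf i)).
by exists (perm injf) => i; rewrite permE.
Qed.

Variable s : 'S_n.+1.
Hypothesis ds : forall i, dec i (s i).

Variant decode_spec i : Prop :=
| LowLeft of X i & i <= z & Y (s i) & s i + i <= z + 3 * a + 3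
    & z <= s i + i + 3 * a + 3 & cnt Y (s i) + cnt X i.+1 = cnt X z.+1
| LowRight of X i & z < i & ~~ Y (s i) & s i + z <= i + 3 * a + 3
    & i <= s i + z + 3 * a + 3 & cnt (predC Y) (s i) + cnt X z.+1 = cnt X i
| HighLeft of ~~ X i & Y (s i)
    & cnt (predC X) i + cnt X z.+1 < cnt Y n.+1
    & cnt Y (s i) = cnt X z.+1 + cnt (predC X) i
    & s i <= z + i + 3 * a + 3 & z + i <= s i + 3 * a + 3
| HighRight of ~~ X i & ~~ Y (s i)
    & cnt Y n.+1 <= cnt (predC X) i + cnt X z.+1
    & cnt (predC Y) (s i) + cnt (predC X) i.+1 + cnt X z.+1
      = cnt X n.+1 + cnt (predC X) n.+1
    & s i + z + i <= 2 * n.+1 + 3 * a + 3 & 2 * n.+1 <= s i + z + i + 3 * a + 3.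

Lemma decodeP i : decode_spec i.
Proof.
have iN := ltn_ord i.
have [Xi|Xi] := boolP (X i).
  have [iz|iz] := leqP i z.
    have [? ? ?] := decodes_low_left bx by_ az azN iN (ltn_ord (s i)) (ds i) Xi
      iz; apply: LowLeft => //.
    by have := ds i; rewrite /decodes Xi iz => -[].
  have [? ? ?] := decodes_low_right bx by_ az azN iN (ltn_ord (s i)) (ds i) Xi
    iz; apply: LowRight => //.
  by have := ds i; rewrite /decodes Xi leqNgt iz => -[].
have [Yi|Yi] := boolP (Y (s i)).
  by have [? ? ? ?] := decodes_high_left bx by_ az azN iN (ltn_ord (s i)) (ds i)
    Xi Yi; exact: HighLeft.
by have [? ? ? ?] := decodes_high_right bx by_ az azN iN (ltn_ord (s i)) (ds i)
  Xi Yi; exact: HighRight.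
Qed.

(** The equation at [z] says that no left value precedes [s z], and the value [0] is forced to be a
    left one. *)
Lemma decode_argmin : s z = ord0.
Proof.
apply: val_inj => /=; case: (decodeP z); rewrite ?ltnn ?xE ?xz//.
move=> _ _ Yz _ _ c0; apply: (cnt_inj Yz Y0).
by rewrite [RHS]big_ord0; natlia.
Qed.

(** Here and for the other three types, points with the same value letter are compared exactly, by
    counting that letter. Points with different letters are compared through the approximate
    locations, for which the margins on [z] leave room, unless their order of positions is
    impossible. *)
Lemma decode_lr_min i : X i -> i <= z -> lr_min s i.
Proof.
move=> Xi iz; apply/lr_minP => j ji.
case: (decodeP i); rewrite ?Xi//; last natlia.
move=> _ _ Yi ? ? ci; case: (decodeP j) => [Xj ? ? ? ? cj|? ?||];
  [|natlia| |natlia].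
  by apply: (@cnt_ltn Y); have := cntS X i; rewrite Xi;
    have := @leq_cnt X j.+1 i ji; natlia.
move=> Xj Yj cj1 cj2 ? ?; apply: (@cnt_ltn Y); rewrite cj2.
by have := cntS X i; rewrite Xi; natlia.
Qed.

Lemma decode_rl_min i : X i -> z < i -> rl_min s i.
Proof.
move=> Xi iz; apply/rl_minP => j ij.
case: (decodeP i); rewrite ?Xi//; first natlia.
move=> _ _ Yi ? ? ci; case: (decodeP j) => [|Xj ? ? ? ? cj||];
  [natlia| |natlia|].
  by apply: (@cnt_ltn (predC Y)); have := ltn_cnt Xi ij; natlia.
move=> Xj Yj cj1 cj2 ? ?; apply: (@cnt_ltn (predC Y)).
have := ltn_cnt Xi (ltn_ord i); have := @leq_cnt (predC X) j.+1 n.+1 (ltn_ord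
  j).
by natlia.
Qed.

Lemma decode_lr_max i : ~~ X i -> Y (s i) -> lr_max s i.
Proof.
move=> Xi Yi; apply/lr_maxP => j ji.
case: (decodeP i); rewrite ?(negPf Xi) ?Yi// => _ _ ? ci ? ?.
case: (decodeP j) => [Xj ? ? ? ? cj|||]; [|natlia| |].
- by apply: (@cnt_ltn Y); have := cntS X j; rewrite Xj; natlia.
- by move=> Xj Yj ? cj ? ?; apply: (@cnt_ltn Y);
  have := @ltn_cnt (predC X) _ _ Xj ji; natlia.
- by move=> Xj Yj ? cj ? ?; have := @ltn_cnt (predC X) _ _ Xj ji; natlia.
Qed.

Lemma decode_rl_max i : ~~ X i -> ~~ Y (s i) -> rl_max s i.
Proof.
move=> Xi Yi; apply/rl_maxP => j ij.
case: (decodeP i); rewrite ?(negPf Xi) ?(negPf Yi)// => _ _ ? ci ? ?.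
have SX k : cnt (predC X) k.+1 = cnt (predC X) k + ~~ X k by rewrite cntS.
case: (decodeP j) => [Xj ? ? ? ? cj|||]; [natlia| | |].
- move=> Xj ? Yj ? ? cj; apply: (@cnt_ltn (predC Y)).
  by have := ltn_cnt Xj (ltn_ord j);
    have := @leq_cnt (predC X) i.+1 n.+1 (ltn_ord i); natlia.
- by move=> Xj Yj ? cj ? ?; have := @ltn_cnt (predC X) _ _ Xi ij; natlia.
- move=> Xj Yj ? cj ? ?; apply: (@cnt_ltn (predC Y)).
  by have := SX i; have := SX j; rewrite Xi Xj;
    have := @leq_cnt (predC X) i.+1 j ij; natlia.
Qed.

Lemma decode_square : is_square s.
Proof.
apply/forallP => i; rewrite /is_record.
have [Xi|Xi] := boolP (X i).
  have [iz|iz] := leqP i z; first by rewrite decode_lr_min ?orbT.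
  by rewrite decode_rl_min ?orbT.
have [Yi|Yi] := boolP (Y (s i)); first by rewrite decode_lr_max.
by rewrite decode_rl_max ?orbT.
Qed.

(** A high point of the left branch is not a left-to-right minimum because the first position,
    forced to be low, has a smaller value; the last position does the same on the right. The other
    type of minimum would lie on the wrong side of a diagonal. *)
Lemma decode_low i : low s i = x i.
Proof.
rewrite -xE; apply/idP/idP => [|Xi]; last first.
  rewrite /low; have [iz|iz] := leqP i z; first by rewrite decode_lr_min.
  by rewrite decode_rl_min ?orbT.
apply: contraTT => Xi; rewrite /low negb_or.
case: (decodeP i); rewrite ?(negPf Xi)// => _ Yi c c' b b'; apply/andP; split.
- apply/negP => /lr_minP/(_ ord0).
  have [i0|i0] := posnP i; first by move: Xi; rewrite i0 X0.
  move/(_ isT); apply/negP; rewrite -leqNgt ltnW//.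
  case: (decodeP ord0); rewrite ?X0 ?ltn0// => _ _ Y0' _ _ /= c0;
    apply: (@cnt_ltn Y).
  by have := cntS X 0; rewrite X0; natlia.
- by apply/negP => /rl_min_le; natlia.
- by apply/negP => /lr_min_le; natlia.
- apply/negP => /rl_minP/(_ ord_max).
  have [iN|iN] := leqP n i.
    have Ei : i = n :> nat by have := ltn_ord i; natlia.
    by move: Xi; rewrite Ei Xn.
  move/(_ isT); apply/negP; rewrite -leqNgt ltnW//.
  case: (decodeP ord_max); rewrite /= ?Xn//; first natlia.
  move=> _ _ Ym _ _ /= cm; apply: (@cnt_ltn (predC Y)).
  have := @ltn_cnt X n n.+1 Xn (leqnn _);
    have := @leq_cnt (predC X) i.+1 n.+1 (ltn_ord i).
  by natlia.
Qed.

Lemma decode_left i : left s i = y (s i).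
Proof.
rewrite -yE; apply/idP/idP => [|Yi]; last first.
  rewrite /left; case: (decodeP i); rewrite ?Yi// => Xi ? ? ? ? ?.
    by rewrite decode_lr_min.
  by rewrite decode_lr_max ?orbT.
apply: contraTT => Yi; rewrite /left negb_or.
case: (decodeP i); rewrite ?(negPf Yi)// => Xi zi Li b b' c; apply/andP; split.
- apply/negP => /lr_min_le_argmin; rewrite leqNgt.
  by rewrite /argmin -decode_argmin permK zi.
- by apply/negP => /lr_max_le; natlia.
- by apply/negP => /lr_min_le; natlia.
- apply/negP => /lr_maxP H.
  (* The largest value is forced to be a left one, so it sits in the high left branch, before every
     point of the high right branch, and refutes that [i] is a left-to-right maximum. *)
  have [m mE] : exists m, s m = ord_max by exists ((s^-1)%g ord_max);
    rewrite permKV.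
  have [im|mi] := leqP i m.
    case: (decodeP m); rewrite mE /= ?Yn//; first by move=> _ ? _ ? _ _; natlia.
    move=> Xm _ cm cm' _ _.
    by have := @leq_cnt (predC X) _ _ im; natlia.
  by have := H _ mi; rewrite mE /= ltnNge -ltnS ltn_ord.
Qed.

(** Three times the error of a branch covers amply the points near the upper corner, whose branch
    may differ from the side at their position. *)
Lemma decode_near : near_sides (9 * a + 9) s z.
Proof.
move=> i; rewrite decode_low -xE; have := ltn_ord (s i); have := ltn_ord i;
  have := ltn_ord z.
by case: (decodeP i) => [->|->|/negPf->|/negPf->]; natlia.
Qed.

End Build.
End Realize.

(** * Counting codes *)

Section Codes.
Variable n : nat.
Local Notation word := {ffun 'I_n.+1 -> bool}.
Implicit Types (x y : word) (s : 'S_n.+1) (z i j : 'I_n.+1) (A : {set 'I_n.+1}).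

Definition anchor A : {set word} := [set x : word | [forall i in A, x i]].

Lemma card_anchor A : #|anchor A| = 2 ^ (n.+1 - #|A|).
Proof.
pose F i : pred bool := if i \in A then pred1 true else predT.
have -> : #|anchor A| = #|family F|.
  apply: eq_card => x; rewrite inE; apply/forall_inP/familyP => H i.
    by rewrite /F; case: ifP => // /H; rewrite inE => ->.
  by move=> iA; have := H i; rewrite /F iA inE => /eqP.
rewrite card_family foldrE big_map big_enum /=.
rewrite (bigID (mem A))/= big1 => [|i iA]; last by rewrite /F iA card1.
rewrite mul1n (eq_bigr (fun=> 2)) => [|i iA]; last first.
  by rewrite /F (negPf iA) card_bool.
rewrite prod_nat_const; congr (2 ^ _).
by apply/esym/eqP; rewrite -(eqn_add2l #|A|) subnKC ?cardC ?card_ord//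
  -[leqRHS]card_ord max_card.
Qed.

Definition code s : word * word :=
  ([ffun i => low s i], [ffun j => left s (s^-1 j)%g]).

Definition anchored z : {set word * word} :=
  finset.setX (anchor [set ord0; ord_max; z]) (anchor [set ord0; ord_max]).

Definition Sq_at z : {set 'S_n.+1} := [set s in Sq n.+1 | argmin s == z].

Lemma anchoredP z (c : word * word) : reflect
  [/\ c.1 ord0, c.1 ord_max, c.1 z, c.2 ord0 & c.2 ord_max] (c \in anchored z).
Proof.
rewrite !inE; apply: (iffP andP) => [[/forall_inP H1 /forall_inP H2]|[? ? ? ?
  ?]].
  by split; [apply: H1|apply: H1|apply: H1|apply: H2|apply: H2];
    rewrite !inE eqxx ?orbT.
split; apply/forall_inP => i; rewrite !inE.
  by move=> /orP[/orP[]|] /eqP->.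
by move=> /orP[] /eqP->.
Qed.

(** At the first and last positions and at the values [0] and [n] the record conditions are vacuous
    or compare with an extreme value; [argmin s] carries the value [0]. *)
Lemma code_anchored s : code s \in anchored (argmin s).
Proof.
apply/anchoredP; split; rewrite /= ffunE.
- by rewrite /low; apply/orP; left; apply/lr_minP.
- rewrite /low; apply/orP; right; apply/rl_minP => j /=.
  by rewrite ltnNge -ltnS ltn_ord.
- rewrite /low; apply/orP; left; apply/lr_minP => j jz; rewrite argminP lt0n.
  by apply: contraTneq jz => sj0; rewrite /argmin -(permK s j) (_ : s j = ord0)
    ?ltnn//; apply/val_inj.
- rewrite /left; apply/orP; left; apply/lr_minP => j jz; rewrite permKV lt0n.
  by apply: contraTneq jz => sj0; rewrite -(permK s j) (_ : s j = ord0) ?ltnn//;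
    apply/val_inj.
- rewrite /left; apply/orP; right; apply/lr_maxP => j jz;
  rewrite permKV ltn_neqAle.
  rewrite -ltnS ltn_ord andbT.
  by apply: contraTneq jz => sj0;
    rewrite -(permK s j) (_ : s j = ord_max) ?ltnn//; apply/val_inj.
Qed.

Lemma code_inj_at z : {in Sq_at z &, injective code}.
Proof.
move=> s t; rewrite !inE => /andP[sqs /eqP zs] /andP[sqt /eqP zt] [E1 E2].
apply: code_inj => //; first by rewrite zs zt.
  by move=> i; have /ffunP/(_ i) := E1; rewrite !ffunE.
by move=> j; have /ffunP/(_ j) := E2; rewrite !ffunE.
Qed.

Lemma card_Sq_at z : #|Sq_at z| <= #|anchored z|.
Proof.
rewrite -(card_in_imset (@code_inj_at z)); apply: subset_leq_card.
by apply/fintype.subsetP => _ /imsetP[s /[!inE] /andP[_ /eqP <-] ->];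
  have := code_anchored s; rewrite !inE.
Qed.

(** For [1 < n] this is [2 ^ (2 * n.+1 - 5)], five letters being forced when [z]
    is neither the first nor the last position. *)
Definition nwords := 2 ^ (n - 2) * 2 ^ (n - 1).

Lemma card_anchored z : 0 < z < n -> #|anchored z| = nwords.
Proof.
move=> /andP[z0 zn]; rewrite cardsX !card_anchor.
have H : (ord0 : 'I_n.+1) != ord_max by rewrite -val_eqE /=; lia.
have -> : #|[set ord0; ord_max; z]| = 3.
  rewrite finset.setUC cardsU1 cards2 H !inE -!val_eqE/=.
  by rewrite gtn_eqF// ltn_eqF.
by rewrite cards2 H /nwords !subSS.
Qed.

(** At an end position [z] coincides with an anchor, and one more letter is free. *)
Lemma card_anchored_le z : 1 < n -> #|anchored z| <= 2 * nwords.
Proof.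
move=> n1; rewrite cardsX !card_anchor.
have H : (ord0 : 'I_n.+1) != ord_max by rewrite -val_eqE /=; lia.
rewrite /nwords [X in _ * 2 ^ (_ - X)]cards2 H mulnA -expnS subSS leq_mul2r.
apply/orP; right; rewrite leq_exp2l// -subSn// leq_sub2l//.
by have := subset_leq_card (finset.subsetUl [set ord0; ord_max] [set z]);
  rewrite cards2 H.
Qed.

Definition balancedb (a : nat) x : bool :=
  [forall t : 'I_n.+2, (t <= (cnt (onat x) t).*2 + a) && ((cnt (onat x) t).*2 <=
    t + a)].

Lemma balancedP a x : balancedb a x -> balanced a (onat x) n.+1.
Proof.
move=> /forallP H t tn; have := H (inord t); rewrite inordK ?ltnS//.
by move=> /andP[].
Qed.

Lemma code_onto z a (c : word * word) : 6 * a + 12 < z ->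
    6 * a + 12 < n.+1 - z ->
  c \in anchored z -> balancedb a c.1 -> balancedb a c.2 ->
  exists2 s, s \in Sq_at z & code s = c /\ near_sides (9 * a + 9) s z.
Proof.
case: c => x y az azN /anchoredP[/= x0 xn xz y0 yn] /balancedP bx /balancedP
  by_.
have [s ds] := decode_perm bx by_ az azN.
exists s.
  rewrite !inE (decode_square bx by_ az azN ds).
  by rewrite /argmin -(decode_argmin xz y0 bx by_ az azN ds) permK eqxx.
split; last exact: decode_near ds.
congr (_, _); apply/ffunP => i; rewrite ffunE.
  exact: (decode_low x0 xn bx by_ az azN ds).
by rewrite (decode_left xz y0 yn bx by_ az azN ds) permKV.
Qed.

(** Codes with an exceptional word are counted among all pairs of words, anchored or not, which
    loses only a factor [2 ^ 5]. The predicate [E] is left open for the condition on signed sums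
    that depends on a test function. *)
Lemma card_near z a (E : pred word) : 6 * a + 12 < z -> 6 * a + 12 < n.+1 - z ->
  #|anchored z| <= #|[set s in Sq_at z | [&& E (code s).1 &
      `[< near_sides (9 * a + 9) s z >]]]|
    + 2 ^ n.+1 * (2 * #|[set x | ~~ balancedb a x]| + #|[set x | ~~ E x]|).
Proof.
move=> az azN.
pose good := [set c in anchored z | [&& balancedb a c.1,
  balancedb a c.2 & E c.1]].
set T := [set s in _ | _].
have gT : #|good| <= #|T|.
  apply: (@leq_trans #|code @: T|); last exact: leq_imset_card.
  apply: subset_leq_card; apply/fintype.subsetP => c; rewrite inE =>
    /andP[cA /and3P[b1 b2 Ec]].
  have [s sS [sc ns]] := code_onto az azN cA b1 b2.
  by apply/imsetP; exists s => //; rewrite inE sS sc Ec/=; apply/asboolP.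
apply: leq_trans (leq_add gT (leqnn _)).
pose B1 := finset.setX [set x | ~~ balancedb a x] [set: word].
pose B2 := finset.setX [set: word] [set x | ~~ balancedb a x].
pose B3 := finset.setX [set x | ~~ E x] [set: word].
apply: (@leq_trans #|good :|: (B1 :|: B2 :|: B3)|).
  apply: subset_leq_card; apply/fintype.subsetP => c cA.
  rewrite /good !inE; move: cA; rewrite !inE => ->.
  by case: (balancedb a c.1); case: (balancedb a c.2); case: (E c.1).
apply: (leq_trans (leq_card_setU _ _)); rewrite leq_add2l.
apply: (leq_trans (leq_card_setU _ _)).
have H := leq_card_setU B1 B2.
apply: (leq_trans (leq_add H (leqnn _))).
rewrite !cardsX cardsT card_ffun card_bool card_ord.
by rewrite mulnDr mul2n -addnn mulnDr leq_add// ?leq_add// mulnC.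
Qed.

End Codes.

(** * Unbalanced words are rare *)

Import Order.TTheory GRing.Theory Num.Theory.
Import numFieldNormedType.Exports.
Local Open Scope ring_scope.

Section SignedSums.
Variables (R : realFieldType) (n : nat) (g : R).
Local Notation word := {ffun 'I_n.+1 -> bool}.
Implicit Types (x : word) (G : nat -> R).

Definition sgn (b : bool) : R := if b then 1 else -1.
Definition signed_sum G x t : R := \sum_(i < t) sgn (onat x i) * G i.

Lemma signed_sumS G x t :
  signed_sum G x t.+1 = signed_sum G x t + sgn (onat x t) * G t.
Proof. by rewrite /signed_sum big_ord_recr. Qed.

Lemma sum_signed_odd G t k : (t < n.+1)%N ->
  \sum_x signed_sum G x t ^+ k * sgn (onat x t) = 0.
Proof.
(* flipping the letter at [t] negates the summand *)
move=> tn; pose flip x : word := [ffun i : 'I_n.+1 => x i (+) (i == t :> nat)].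
have flipK : involutive flip.
  by move=> x; apply/ffunP => i; rewrite !ffunE addbK.
have E x : signed_sum G (flip x) t ^+ k * sgn (onat (flip x) t) =
    - (signed_sum G x t ^+ k * sgn (onat x t)).
  rewrite -mulrN; congr (_ ^+ k * _).
    apply: eq_bigr => i _; congr (sgn _ * _).
    rewrite /onat ffunE inordK; last by rewrite (ltn_trans _ tn).
    by rewrite ltn_eqF ?addbF.
  rewrite /onat ffunE inordK// eqxx addbT /sgn.
  by case: (x _); rewrite //= opprK.
set S := LHS; suff : S = - S by lra.
by rewrite {1}/S (reindex_inj (inv_inj flipK))/= (eq_bigr _ (fun x _ =>
  E x)) sumrN.
Qed.

Variable G : nat -> R.
Hypothesis Gg : forall i, `|G i| <= g.

Let G2 i : G i ^+ 2 <= g ^+ 2.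
Proof. by rewrite -real_normK ?num_real// ler_sqr ?nnegrE// (le_trans _ (Gg i)).
Qed.

Let sgn2 b : sgn b ^+ 2 = 1 :> R.
Proof. by rewrite /sgn; case: b; rewrite ?sqrrN expr1n. Qed.

Let card_word : \sum_(x : word) 1 = 2 ^+ n.+1 :> R.
Proof.
by rewrite sumr_const card_ffun card_bool card_ord -natrX.
Qed.

Lemma sum_signed_sq t : (t <= n.+1)%N ->
  \sum_x signed_sum G x t ^+ 2 <= t%:R * g ^+ 2 * 2 ^+ n.+1.
Proof.
elim: t => [_|t IH tn].
  rewrite mul0r mul0r big1// => x _.
  by rewrite /signed_sum big_ord0 expr0n.
have E x : signed_sum G x t.+1 ^+ 2 = signed_sum G x t ^+ 2 +
    2 * G t * (signed_sum G x t ^+ 1 * sgn (onat x t)) + G t ^+ 2 * 1.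
  by rewrite signed_sumS -[in G t ^+ 2 * 1](sgn2 (onat x t)); ring.
rewrite (eq_bigr _ (fun x _ => E x)) !big_split/= -!mulr_sumr.
rewrite sum_signed_odd// mulr0 addr0 card_word.
rewrite -[t.+1%:R]natr1 !mulrDl mul1r lerD ?IH 1?ltnW//.
by rewrite ler_wpM2r// exprn_ge0.
Qed.

(** Odd powers of the new sign cancel in the sum over words. What remains adds, per word, at most
    [6 * t + 1] times [g ^ 4], within the increment [6 * t + 3] of [3 * t ^ 2]. *)
Lemma sum_signed_quartic t : (t <= n.+1)%N ->
  \sum_x signed_sum G x t ^+ 4 <= 3 * t%:R ^+ 2 * g ^+ 4 * 2 ^+ n.+1.
Proof.
elim: t => [_|t IH tn].
  rewrite expr0n mulr0 !mul0r big1// => x _.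
  by rewrite /signed_sum big_ord0 expr0n.
have E x : signed_sum G x t.+1 ^+ 4 = signed_sum G x t ^+ 4 +
    4 * G t * (signed_sum G x t ^+ 3 * sgn (onat x t)) +
    6 * G t ^+ 2 * signed_sum G x t ^+ 2 +
    4 * G t ^+ 3 * (signed_sum G x t ^+ 1 * sgn (onat x t)) + G t ^+ 4 * 1.
  rewrite signed_sumS; have := sgn2 (onat x t); set s := sgn _ => s2.
  have s3 : s ^+ 3 = s by rewrite exprS s2 mulr1.
  have s4 : s ^+ 4 = 1 by rewrite (exprM s 2 2) s2 expr1n.
  rewrite -[in RHS]s4 [in X in _ = _ + X + _]mulrA; move: s2 s3 s4.
  set w := signed_sum G x t; set h := G t => s2 s3 s4.
  have -> : (w + s * h) ^+ 4 = w ^+ 4 + 4 * h * (w ^+ 3 * s) + 6 * h ^+ 2 * w ^+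
    2 * s ^+ 2
     + 4 * h ^+ 3 * w * s ^+ 3 + h ^+ 4 * s ^+ 4 by ring.
  by rewrite s2 s3 s4; ring.
rewrite (eq_bigr _ (fun x _ => E x)) !big_split/= -!mulr_sumr.
rewrite !sum_signed_odd// !mulr0 !addr0 card_word.
have W : 0 < 2 ^+ n.+1 :> R by rewrite exprn_gt0.
have H4 : G t ^+ 4 <= g ^+ 4.
  by rewrite !(exprM _ 2 2) ler_sqr ?nnegrE ?sqr_ge0// G2.
have H2 : G t ^+ 2 * \sum_x signed_sum G x t ^+ 2 <= g ^+ 2 * (t%:R * g ^+ 2 *
  2 ^+ n.+1).
  by apply: ler_pM; rewrite ?sqr_ge0 ?sumr_ge0 ?G2 ?sum_signed_sq 1?ltnW// =>
    x _; rewrite sqr_ge0.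
have T : 0 <= t%:R :> R by rewrite ler0n.
have g4 : 0 <= g ^+ 4 * 2 ^+ n.+1 by apply: mulr_ge0;
  [exact: exprn_even_ge0|exact: exprn_ge0].
have H5 : G t ^+ 4 * 2 ^+ n.+1 <= g ^+ 4 * 2 ^+ n.+1 by rewrite ler_wpM2r// ltW.
have -> : 3 * t.+1%:R ^+ 2 * g ^+ 4 * 2 ^+ n.+1 = 3 * t%:R ^+ 2 * g ^+ 4 * 2 ^+
  n.+1
   + 6 * (g ^+ 2 * (t%:R * g ^+ 2 * 2 ^+ n.+1)) + 3 * (g ^+ 4 * 2 ^+ n.+1).
  by rewrite -[t.+1%:R]natr1; ring.
have := IH (ltnW tn); rewrite -[6 * _ * _]mulrA.
lra.
Qed.

Lemma markov_sum (F : word -> R) (c : R) : (forall x, 0 <= F x) -> 0 <= c ->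
  #|[set x | c < F x]|%:R * c <= \sum_x F x.
Proof.
move=> F0 c0; rewrite mulr_natl -sumr_const [leRHS](bigID (mem [set x |
  c < F x]))/=.
rewrite -[leLHS]addr0 lerD ?sumr_ge0//.
by apply: ler_sum => x; rewrite inE => /ltW.
Qed.

End SignedSums.

Section Unbalanced.
Variables (R : realFieldType) (n : nat).
Local Notation word := {ffun 'I_n.+1 -> bool}.

Lemma cnt_signed (x : word) t :
  (cnt (onat x) t).*2%:R = t%:R + signed_sum (fun=> 1) x t :> R.
Proof.
elim: t => [|t IH]; first by rewrite /cnt /signed_sum !big_ord0 addr0.
rewrite signed_sumS cntS doubleD natrD IH -[t.+1%:R]natr1 /sgn mulr1.
by rewrite -(mul2n (onat x t)) natrM; case: (onat x t) => /=; ring.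
Qed.

(** Markov's inequality for fourth powers, summed over the [n.+2] prefixes: for [a] proportional to
    [n] the unbalanced words have proportion [O(1 / n)]. *)
Lemma card_unbalanced (a : nat) :
  #|[set x : word | ~~ balancedb a x]|%:R * a%:R ^+ 4 <=
  (3 * n.+2%:R ^+ 3) * 2 ^+ n.+1 :> R.
Proof.
pose B (t : 'I_n.+2) := [set x : word | a%:R ^+ 4 < signed_sum (fun=>
  1 : R) x t ^+ 4].
have sub : [set x : word | ~~ balancedb a x] \subset \bigcup_t B t.
  apply/fintype.subsetP => x; rewrite inE negb_forall => /existsP[t tb].
  apply/bigcupP; exists t => //; rewrite inE.
  have : a%:R < `|signed_sum (fun=> 1 : R) x t|.
    rewrite ltNge; apply: contra tb; rewrite ler_norml => /andP[l u].
    by rewrite -!(ler_nat R) !natrD cnt_signed; apply/andP; split; lra.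
  by move=> H; rewrite -[ltRHS]ger0_norm ?exprn_even_ge0// normrX ltrXn2r
    ?nnegrE ?ler0n ?normr_ge0.
have H1 : (#|[set x : word | ~~ balancedb a x]| <= \sum_t #|B t|)%N.
  apply: (leq_trans (subset_leq_card sub)).
  elim/big_rec2: _ => [|t c A _ le]; first by rewrite cards0.
  by apply: (leq_trans (leq_card_setU _ _)); rewrite leq_add2l.
apply: le_trans (_ : (\sum_t #|B t|)%:R * a%:R ^+ 4 <= _).
  by rewrite ler_wpM2r ?exprn_ge0 ?ler0n// ler_nat.
rewrite natr_sum mulr_suml.
apply: le_trans (_ : \sum_(t < n.+2) 3 * n.+2%:R ^+ 2 * 2 ^+ n.+1 <= _);
  last first.
  by rewrite sumr_const card_ord -[leLHS]mulr_natr; rewrite le_eqVlt; apply/orP;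
    left; apply/eqP; ring.
apply: ler_sum => t _.
apply: le_trans (markov_sum _ _) _; rewrite ?exprn_ge0 ?ler0n//.
  by move=> x; rewrite exprn_even_ge0.
have tn : (t <= n.+1)%N by rewrite -ltnS ltn_ord.
apply: le_trans (@sum_signed_quartic R n 1 _ _ t tn) _; first by move=> _;
  rewrite normr1.
rewrite expr1n mulr1 ler_wpM2r ?exprn_ge0// ler_wpM2l// lerXn2r ?nnegrE
  ?ler0n//.
by rewrite ler_nat leqW.
Qed.

Lemma card_large_signed (G : nat -> R) (g c : R) : (forall i, `|G i| <= g) ->
    0 <= c ->
  #|[set x : word | c < `|signed_sum G x n.+1|]|%:R * c ^+ 2 <=
  n.+1%:R * g ^+ 2 * 2 ^+ n.+1.
Proof.
move=> Gg c0; apply: le_trans (sum_signed_sq Gg (leqnn _)).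
have -> : [set x : word | c < `|signed_sum G x n.+1|] =
    [set x | c ^+ 2 < signed_sum G x n.+1 ^+ 2].
  by apply/finset.setP => x; rewrite !inE -(real_normK (num_real (signed_sum G x
    n.+1))) ltr_sqr ?nnegrE ?normr_ge0.
by apply: markov_sum; rewrite ?sqr_ge0// => x; rewrite sqr_ge0.
Qed.

End Unbalanced.

(** * Integrals of test functions *)

Local Open Scope classical_set_scope.
Local Open Scope ring_scope.

Section UnitMassIntegral.
Context (d : measure_display) (T : measurableType d) (R : realType).
Variables (mu : {measure set T -> \bar R}) (D : set T).
Hypotheses (mD : measurable D) (muD : mu D = 1%E).
Implicit Types f g : T -> R.

Lemma bounded_integrable f (M : R) : measurable_fun D f ->
  (forall x, D x -> `|f x| <= M) -> mu.-integrable D (EFin \o f).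
Proof.
move=> mf fM; apply: measurable_bounded_integrable => //;
  first by rewrite muD ltry.
exists M; split; first exact: num_real.
by move=> u Mu x Dx; rewrite /= (le_trans (fM x Dx))// ltW.
Qed.

Lemma Rintegral_cst1 (c : R) : \int[mu]_(_ in D) c = c.
Proof. by rewrite Rintegral_cst// muD mulr1. Qed.

Lemma Rintegral_close f g (h : T -> R) : mu.-integrable D (EFin \o f) ->
  mu.-integrable D (EFin \o g) -> mu.-integrable D (EFin \o h) ->
  (forall x, D x -> `|f x - g x| <= h x) ->
  `|\int[mu]_(x in D) f x - \int[mu]_(x in D) g x| <= \int[mu]_(x in D) h x.
Proof.
move=> fi gi hi fg; rewrite -RintegralB//.
have fgi : mu.-integrable D (EFin \o (fun x => f x - g x)).
  exact: (integrableB mD fi gi).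
apply: le_trans (le_normr_Rintegral mD fgi) _.
apply: le_Rintegral => //; exact: integrable_norm.
Qed.

Lemma Rintegral_sumr (I : Type) (r : seq I) (F : I -> T -> R) :
  (forall i, mu.-integrable D (EFin \o F i)) ->
  \int[mu]_(x in D) (\sum_(i <- r) F i x) =
    \sum_(i <- r) \int[mu]_(x in D) F i x /\
  mu.-integrable D (EFin \o (fun x => \sum_(i <- r) F i x)).
Proof.
move=> Fi; elim: r => [|i r [IHr IHi]].
  split; first by under eq_Rintegral do rewrite big_nil;
    rewrite big_nil Rintegral_cst1.
  rewrite (_ : _ \o _ = EFin \o cst 0); last by apply/funext => x /=;
    rewrite big_nil.
  by apply: (@bounded_integrable _ 0) => // x _; rewrite normr0.
have E : (fun x => \sum_(i <- i :: r) F i x) = (fun x =>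
  F i x + \sum_(i <- r) F i x).
  by apply/funext => x; rewrite big_cons.
rewrite E; split; last exact: (integrableD mD (Fi i) IHi).
by rewrite big_cons -IHr RintegralD.
Qed.

(** The lower bounds [w i] on the masses are in fact equalities, as they sum to
    the total mass. *)
Lemma Rintegral_step (I : finType) (B : I -> set T) (c w : I -> R) f (M e : R) :
  measurable_fun D f -> (forall x, D x -> `|f x| <= M) ->
  (forall i, measurable (B i)) ->
  (forall i j x, B i x -> B j x -> i = j) ->
  (forall i x, D x -> B i x -> `|f x - c i| <= e) ->
  (forall i, ((w i)%:E <= mu (B i `&` D))%E) -> \sum_i w i = 1 ->
  `|\int[mu]_(x in D) f x - \sum_i c i * w i| <= e.
Proof.
move=> mf fM mB dB Be Bw w1.
have Bfin i : mu (B i `&` D) \is a fin_num.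
  rewrite fin_numElt (lt_le_trans (ltNyr 0%R)) ?measure_ge0//=.
  rewrite (le_lt_trans _ (ltry 1))// -muD le_measure ?inE//.
    exact: measurableI.
pose p i := fine (mu (B i `&` D)).
have indB i : \int[mu]_(x in D) \1_(B i) x = p i.
  by rewrite /Rintegral integral_indic.
have indi i : mu.-integrable D (EFin \o \1_(B i)).
  apply: (@bounded_integrable _ 1); first exact: measurable_indic.
  by move=> x _; rewrite indicE; case: (_ \in _); rewrite ?normr1 ?normr0.
have cindi i : mu.-integrable D (EFin \o (fun x => c i * \1_(B i) x)).
  by apply: (@integrableZl _ _ _ mu D mD (c i) (EFin \o \1_(B i))).
pose g x := \sum_i c i * \1_(B i) x.
pose s x := \sum_i \1_(B i) x : R.
have [sE si] := Rintegral_sumr (index_enum I) indi.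
have [gE gi] := Rintegral_sumr (index_enum I) cindi.
have in1 i x : B i x -> forall F : I -> R, \sum_j F j * \1_(B j) x = F i.
  move=> Bix F; rewrite (bigD1 i)//= indicE mem_set// mulr1 big1 ?addr0// =>
    j ji.
  by rewrite indicE memNset ?mulr0// => Bjx; move: ji;
    rewrite (dB _ _ _ Bjx Bix) eqxx.
have s01 x : (exists i, B i x) \/ s x = 0 /\ g x = 0.
  have [[i Bix]|nB] := pselect (exists i, B i x); first by left; exists i.
  right; split; rewrite /s /g big1// => i _; rewrite indicE memNset ?mulr0//;
    by move=> Bix; apply: nB; exists i.
have s1 i x : B i x -> s x = 1.
  by move=> Bix; rewrite -(in1 i x Bix (fun=> 1)); apply: eq_bigr => j _;
    rewrite mul1r.
have sp : \int[mu]_(x in D) s x = \sum_i p i.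
  by rewrite sE; apply: eq_bigr => i _; rewrite indB.
have p1 : \sum_i p i <= 1.
  rewrite -sp -(Rintegral_cst1 1); apply: le_Rintegral => //.
    by apply: (@bounded_integrable _ 1) => // x _; rewrite normr1.
  by move=> x _; case: (s01 x) => [[i /s1->//]|[-> _]].
have wp i : w i <= p i by rewrite -lee_fin fineK.
have pw i : p i = w i.
  apply/eqP; rewrite eq_le wp andbT.
  rewrite (bigD1 i)//= in p1; rewrite (bigD1 i)//= in w1.
  have : \sum_(j | j != i) w j <= \sum_(j | j != i) p j by apply: ler_sum.
  by move: p1 w1; lra.
have M0 : (exists x, D x) -> 0 <= M by move=> [x /fM]; exact: le_trans.
have -> : \sum_i c i * w i = \int[mu]_(x in D) g x.
  rewrite gE; apply: eq_bigr => i _.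
  by rewrite RintegralZl// indB pw.
(* [s] is the indicator of the union of the [B i], which has full mass. Off the union only the bound
   [M] is available, and it contributes nothing to the integral. *)
have hE : \int[mu]_(x in D) (e * s x + M * (1 - s x)) = e.
  have s0 : mu.-integrable D (EFin \o (fun x => 1 - s x)).
    apply: (@integrableB _ _ _ mu D mD (EFin \o cst 1) (EFin \o s)) => //.
    by apply: (@bounded_integrable _ 1) => // x _; rewrite normr1.
  rewrite RintegralD//.
  - rewrite !RintegralZl// RintegralB//; last first.
      by apply: (@bounded_integrable _ 1) => // x _; rewrite normr1.
    rewrite Rintegral_cst1 sp (eq_bigr w) ?w1//;
      by rewrite subrr mulr0 addr0 mulr1.
  - exact: (@integrableZl _ _ _ mu D mD e (EFin \o s)).
  - exact: (@integrableZl _ _ _ mu D mD M (EFin \o (fun x => 1 - s x))).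
rewrite -[leRHS]hE; apply: Rintegral_close => //.
- exact: bounded_integrable mf fM.
- apply: (@integrableD _ _ _ mu D mD (EFin \o (fun x =>
  e * s x)) (EFin \o (fun x => M * (1 - s x)))).
    exact: (@integrableZl _ _ _ mu D mD e (EFin \o s)).
  apply: (@integrableZl _ _ _ mu D mD M (EFin \o (fun x => 1 - s x))).
  apply: (@integrableB _ _ _ mu D mD (EFin \o cst 1) (EFin \o s)) => //.
  by apply: (@bounded_integrable _ 1) => // x _; rewrite normr1.
- move=> x Dx; case: (s01 x) => [[i Bix]|[-> ->]].
    by rewrite (s1 _ _ Bix) subrr mulr0 addr0 mulr1 /g (in1 _ _ Bix) Be.
  by rewrite mulr0 add0r !subr0 mulr1 fM.
Qed.

End UnitMassIntegral.

Section PlaneMeasurability.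
Variable R : realType.
Local Notation plane := (measurableTypeR R * measurableTypeR R)%type.

(** This links the product topology with the product sigma-algebra: an open set is a union of boxes
    with rational centres and radii [1 / (k + 1)], of which there are countably many. *)
Lemma open_measurable_plane (U : set (R * R)) : open U ->
    measurable (U : set plane).
Proof.
move=> oU.
pose box (q : rat * rat * nat) : set plane :=
  `](ratr q.1.1 - q.2.+1%:R^-1), (ratr q.1.1 + q.2.+1%:R^-1)[ `*`
  `](ratr q.1.2 - q.2.+1%:R^-1), (ratr q.1.2 + q.2.+1%:R^-1)[.
have -> : U = \bigcup_(q in [set q | box q `<=` U]) box q.
  apply/seteqP; split=> [[x y] Uxy|p [q /= qU /qU//]].
  have /nbhs_ballP[e /= e0 eU] := oU _ Uxy.
  have [k ke] : exists k : nat, k.+1%:R^-1 < e / 2.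
    have e2 : 0 < e / 2 by rewrite divr_gt0.
    exists (Num.truncn (e / 2)^-1); rewrite invf_plt ?posrE ?ltr0n//.
    by rewrite truncnS_gt.
  have k0 : 0 < k.+1%:R^-1 :> R by rewrite invr_gt0 ltr0n.
  have apx (u : R) : exists r : rat, `|u - ratr r| < k.+1%:R^-1.
    have uu : u - k.+1%:R^-1 < u + k.+1%:R^-1 by rewrite ltrBlDr -addrA ltrDl
      addr_gt0.
    have [r] := rat_in_itvoo uu.
    rewrite in_itv/= => /andP[r1 r2]; exists r.
    by move: k0 r1 r2; move: (k.+1%:R^-1) => h *; rewrite ltr_norml; apply/andP;
      split; lra.
  have [a ax] := apx x; have [b by_] := apx y.
  exists (a, b, k); last first.
    move: ax by_; rewrite !ltr_norml /box /=.
    move: (k.+1%:R^-1) => h /andP[? ?] /andP[? ?].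
    by split; rewrite /= in_itv/=; apply/andP; split; lra.
  move=> [u v] [/=]; rewrite !in_itv/=.
  move: ax by_ ke; rewrite !ltr_norml.
  move: (k.+1%:R^-1) => h /andP[? ?] /andP[? ?] ? /andP[? ?] /andP[? ?];
    apply: eU.
  by split; rewrite /= /ball/= ltr_norml; apply/andP; split; lra.
rewrite bigcup_mkcond; apply: countable_bigcupT_measurable => [|q].
  exact: countableP.
by case: ifP => // _; apply: measurableX; exact: measurable_itv.
Qed.

Lemma continuous_measurable_plane (f : R * R -> R) : continuous f ->
  measurable_fun [set: plane] (f : plane -> measurableTypeR R).
Proof.
move=> cf; apply: (measurability _ (RGenOpens.measurableE R)).
move=> _ [_ [a [b ->] <-]]; rewrite setTI; apply: open_measurable_plane.
move/continuousP: cf; apply; exact: interval_open.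
Qed.

End PlaneMeasurability.

Section Clamp.
Variable R : realType.
Implicit Types x y : R.

Definition clamp x : R := Num.max 0 (Num.min x 1).

Lemma clamp_id x : 0 <= x <= 1 -> clamp x = x.
Proof. by move=> /andP[x0 x1]; rewrite /clamp min_l// max_r. Qed.

Lemma clamp01 x : 0 <= clamp x <= 1.
Proof. by rewrite /clamp le_max lexx ge_max ler01 ge_min lexx orbT. Qed.

Lemma clamp_lipschitz x y : `|clamp x - clamp y| <= `|x - y|.
Proof.
have : - `|x - y| <= x - y <= `|x - y| by rewrite -ler_norml.
move: `|x - y| => h /andP[? ?]; rewrite ler_norml /clamp.
case: (leP x 1) => ?; case: (leP y 1) => ?; rewrite ?(max_r ler01);
  case: (leP 0 x) => ?; case: (leP 0 y) => ?; apply/andP; split; lra.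
Qed.

End Clamp.

Section Extend.
Variables (R : realType) (f : test_function R).

(** Composing with the retraction onto the square makes a test function continuous and bounded on
    the whole plane, with the same integral against every permuton. *)
Definition extend (p : R * R) : R := sval f (clamp p.1, clamp p.2).

Lemma clamp_square (p : R * R) : @unit_square R (clamp p.1, clamp p.2).
Proof. by split; rewrite /= in_itv/= clamp01. Qed.

Lemma extendE p : @unit_square R p -> extend p = sval f p.
Proof.
case: p => x y [/=]; rewrite !in_itv/= => x01 y01.
by rewrite /extend/= !clamp_id.
Qed.

Lemma extend_continuous : continuous extend.
Proof.
move=> p; rewrite /extend /continuous_at.
have /subspace_continuousP/(_ _ (clamp_square p)) H := svalP f.
have C : (fun q : R * R => (clamp q.1, clamp q.2)) @ p -->
    within (@unit_square R) (nbhs (clamp p.1, clamp p.2)).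
  move=> A /nbhs_ballP[e /= e0 eA]; apply/nbhs_ballP; exists e => //= q [b1 b2].
  apply: eA; last exact: clamp_square.
  by split; apply: le_lt_trans (clamp_lipschitz _ _) _.
exact: cvg_comp C H.
Qed.

Lemma extend_measurable :
  measurable_fun setT (extend : plane R -> measurableTypeR R).
Proof. exact: continuous_measurable_plane extend_continuous. Qed.

Lemma compact_unit_square : compact (@unit_square R).
Proof. by apply: compact_setX; exact: segment_compact. Qed.

Lemma extend_clamp p : extend (clamp p.1, clamp p.2) = extend p.
Proof. by rewrite extendE//; exact: clamp_square. Qed.

Lemma extend_bounded : exists M, forall p, `|extend p| <= M.
Proof.
have /compact_bounded[M [_ HM]] := continuous_compact (svalP f)
  compact_unit_square.
exists (M + 1) => p; apply: HM; first by rewrite ltrDl.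
by exists (clamp p.1, clamp p.2) => //; exact: clamp_square.
Qed.

Lemma extend_uniform (e : R) : 0 < e -> exists2 dl, 0 < dl &
  forall p q : R * R, `|p.1 - q.1| <= dl -> `|p.2 - q.2| <= dl ->
    `|extend p - extend q| <= e.
Proof.
move=> e0.
pose P (dl : R) (p : R * R) := forall q : R * R, `|p.1 - q.1| <= dl ->
  `|p.2 - q.2| <= dl ->
    `|extend p - extend q| <= e.
have : \forall dl \near 0^'+, @unit_square R `<=` P dl.
  apply: ((compact_near_coveringP _).1 compact_unit_square) => x _.
  have e2 : 0 < e / 2 by rewrite divr_gt0.
  have /cvgrPdist_lt/(_ _ e2)/nbhs_ballP[r /= r0 Hr] := @extend_continuous x.
  exists (ball x (r / 2), [set dl : R | dl < r / 2]).
    split; first by apply: nbhsx_ballx; rewrite divr_gt0.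
    by apply: nbhs_right_lt; rewrite divr_gt0.
  move=> [p dl] [/= [b1 b2] dr] q q1 q2.
  have Hp : ball x r p.
    by split; [apply: le_ball b1|apply: le_ball b2]; lra.
  have Hq : ball x r q.
    move: b1 b2; rewrite /ball /= => b1 b2; split; rewrite /ball/=.
      by have := ler_distD p.1 x.1 q.1; lra.
    by have := ler_distD p.2 x.2 q.2; lra.
  have := ler_distD (extend x) (extend p) (extend q).
  have := Hr _ Hp; have := Hr _ Hq; rewrite /= [`|extend p - extend x|]distrC;
    lra.
move=> H; have [dl [dl0 Hdl]] : exists dl, 0 < dl /\ @unit_square R `<=` P dl.
  by near (0 : R)^'+ => dl; exists dl; split; [near: dl;
    exact: nbhs_right_gt|near: dl].
exists dl => // p q pq1 pq2; rewrite -(extend_clamp p) -(extend_clamp q).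
apply: Hdl; first exact: clamp_square.
  exact: le_trans (clamp_lipschitz _ _) pq1.
exact: le_trans (clamp_lipschitz _ _) pq2.
Unshelve. all: by end_near. Qed.

End Extend.

Section PermutonIntegral.
Variable R : realType.
Implicit Types (mu : permuton R) (f : test_function R).

Lemma measurable_unit_square : measurable (@unit_square R : set (plane R)).
Proof. by apply: measurableX; exact: measurable_itv. Qed.

Lemma permuton_unit_square mu : mu (@unit_square R) = 1%E.
Proof. by have [-> _] := permutonP mu (lexx 0) ler01 (lexx 1); rewrite subr0.
Qed.

Lemma extend_integrable mu f : mu.-integrable setT (EFin \o extend f).
Proof.
have [M HM] := extend_bounded f.
apply: (@bounded_integrable _ _ _ mu setT measurableT (probability_setT mu) _ M)
  => //.
exact: extend_measurable.
Qed.

Lemma permuton_integralE mu f : permuton_integral mu f = \int[mu]_p extend f p.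
Proof.
rewrite /permuton_integral; transitivity (\int[mu]_(p in @unit_square R) extend
  f p).
  by apply: eq_Rintegral => p /set_mem pU; rewrite extendE.
have muC : mu (~` @unit_square R) = 0%E.
  rewrite probability_setC ?permuton_unit_square ?subee//.
  exact: measurable_unit_square.
rewrite /Rintegral; congr fine.
rewrite [RHS](@negligible_integral _ _ _ mu setT (~` @unit_square R : set (plane
  R)))//.
- by rewrite setTD setCK.
- by apply: measurableC; exact: measurable_unit_square.
- exact: extend_integrable.
Qed.

End PermutonIntegral.

(** * The sides of the rectangle as two graphs *)

Section Sides.
Variable R : realType.
Implicit Types (x y z : R) (f : test_function R).
Local Notation leb := (@lebesgue_measure R).

(** Over [[0, 1]], [side1] and [side3] form the graph of [lower z], while [side2] and [side4] form
    that of [upper z]. *)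
Definition lower z x : R := `|x - z|.
Definition upper z x : R := 1 - `|x - (1 - z)|.

(** The interval is open because for [0 < z < 1] the graphs meet over the points [0] and [1]; lower
    and upper strips within [[0, 1]] are then disjoint. *)
Definition strip (h : R -> R) (u v : R) : set (plane R) :=
  [set p | u < p.1 < v /\ p.2 = h p.1].

Lemma measurable_strip (h : R -> R) u v : continuous h ->
    measurable (strip h u v).
Proof.
move=> ch; rewrite (_ : strip h u v = (`]u, v[ `*` setT) `&`
    ((fun p : plane R => p.2 - h p.1) @^-1` [set 0])); last first.
  apply/seteqP; split=> -[x y]; rewrite /strip /= in_itv/=.
    by move=> [-> ->]; rewrite subrr.
  by move=> [[-> _] /subr0_eq].
apply: measurableI; first by apply: measurableX => //; exact: measurable_itv.
rewrite -[X in measurable X]setTI; apply: measurable_funB => //.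
apply: measurableT_comp => //; exact: continuous_measurable_fun.
Qed.

Lemma segmentP (a b c e : R) p : a <= b ->
  segment (a, c + e * a) (b, c + e * b) p <->
  a <= p.1 <= b /\ p.2 = c + e * p.1.
Proof.
move=> ab; split=> [[t /=]|].
  by rewrite in_itv/= => /andP[t0 t1] <-/=; split; [nra|ring].
case: p => x y [/= /andP[ax xb] ->].
have [ab0|ab0] := eqVneq a b.
  exists 0; first by rewrite /= in_itv/= lexx ler01.
  by rewrite (_ : x = a) /=; [congr (_, _); ring|lra].
have ba : 0 < b - a by rewrite subr_gt0 lt_neqAle ab0.
exists ((x - a) / (b - a)).
  rewrite /= in_itv/= divr_ge0 ?subr_ge0//=.
  by rewrite ler_pdivrMr// mul1r lerD2r.
by rewrite /=; congr (_, _); field; rewrite gt_eqF.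
Qed.

Lemma segment_measure_strip (a b c e u v y0 y1 : R) (h : R -> R) : a <= b ->
  y0 = c + e * a -> y1 = c + e * b ->
  (forall x, a <= x <= b -> h x = c + e * x) ->
  segment_measure (segment (a, y0) (b, y1)) (strip h u v) =
  ((2^-1)%:E * leb (`]u, v[ `&` `[a, b]))%E.
Proof.
move=> ab -> -> hE; rewrite /segment_measure; congr (_ * leb _)%E.
apply/seteqP; split=> x /=; rewrite !in_itv/=.
  by move=> [[x' y] [[/= uv _] /(segmentP _ _ _ ab)[/= xab _]] <-].
move=> [uv xab]; exists (x, h x) => //; split=> //.
by apply/segmentP => //=; rewrite hE.
Qed.

Lemma leb_split (u v a : R) : 0 <= u -> u <= v -> v <= 1 -> 0 <= a <= 1 ->
  ((v - u)%:E <= leb (`]u, v[ `&` `[0%R, a]) + leb (`]u, v[ `&` `[a, 1%R]))%E.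
Proof.
move=> u0 uv v1 /andP[a0 a1].
have -> : ((v - u)%:E = leb `]u, v[)%E.
  rewrite lebesgue_measure_itv/= lte_fin; case: ltP => // vu.
  by rewrite (_ : v = u) ?subrr//; apply: le_anti; rewrite vu uv.
apply: le_trans (measureU2 _ _ _); [|exact: measurableI|exact: measurableI].
rewrite -setIUr; apply: le_measure; rewrite ?inE//.
  by apply: measurableI => //; exact: measurableU.
move=> x /= xuv; split=> //; move: xuv; rewrite !in_itv/= => /andP[ux xv].
have [xa|ax] := leP x a; [left|right]; apply/andP; split; lra.
Qed.

Lemma rectangle_strip_lower z (z01 : 0 <= z <= 1) u v : 0 <= u -> u <= v ->
    v <= 1 ->
  ((2^-1 * (v - u))%:E <= segment_measure (side1 z) (strip (lower z) u v) +
    segment_measure (side3 z) (strip (lower z) u v))%E.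
Proof.
move=> u0 uv v1; have /andP[z0 z1] := z01.
rewrite /side1 /side3.
rewrite (@segment_measure_strip _ _ z (-1)); [|lra|lra|lra|]; last first.
  by move=> x /andP[_ xz]; rewrite /lower ler0_norm ?subr_le0//; ring.
rewrite (@segment_measure_strip _ _ (- z) 1); [|lra|lra|lra|]; last first.
  by move=> x /andP[xz _]; rewrite /lower ger0_norm ?subr_ge0//; ring.
rewrite -ge0_muleDr// EFinM lee_pmul2l// ?lte_fin ?invr_gt0//.
exact: leb_split.
Qed.

Lemma rectangle_strip_upper z (z01 : 0 <= z <= 1) u v : 0 <= u -> u <= v ->
    v <= 1 ->
  ((2^-1 * (v - u))%:E <= segment_measure (side2 z) (strip (upper z) u v) +
    segment_measure (side4 z) (strip (upper z) u v))%E.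
Proof.
move=> u0 uv v1; have /andP[z0 z1] := z01.
rewrite /side2 /side4.
rewrite (@segment_measure_strip _ _ z 1); [|lra|lra|lra|]; last first.
  by move=> x /andP[_ xz]; rewrite /upper ler0_norm ?subr_le0//; ring.
rewrite (@segment_measure_strip _ _ (2 - z) (-1)); [|lra|lra|lra|]; last first.
  by move=> x /andP[xz _]; rewrite /upper ger0_norm ?subr_ge0//; ring.
rewrite -ge0_muleDr// EFinM lee_pmul2l// ?lte_fin ?invr_gt0//.
by apply: leb_split => //; lra.
Qed.

Lemma lower_lipschitz z x y : `|lower z x - lower z y| <= `|x - y|.
Proof.
apply: le_trans (ler_dist_dist _ _) _.
by rewrite (_ : x - z - (y - z) = x - y)//; ring.
Qed.

Lemma upper_lipschitz z x y : `|upper z x - upper z y| <= `|x - y|.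
Proof.
have E (a b : R) : 1 - a - (1 - b) = b - a by ring.
rewrite /upper distrC E.
apply: le_trans (ler_dist_dist _ _) _.
by rewrite (_ : _ - _ - _ = x - y)//; ring.
Qed.

Lemma lipschitz_continuous (h : R -> R) : (forall x y, `|h x - h y|
    <= `|x - y|) -> continuous h.
Proof.
move=> hl x; apply/cvgrPdist_lt => e e0; near=> y.
by apply: le_lt_trans (hl _ _) _; near: y; exact: cvgr_dist_lt.
Unshelve. all: by end_near. Qed.

Lemma lower_lt_upper z x : 0 < z < 1 -> 0 < x < 1 -> lower z x < upper z x.
Proof.
move=> /andP[? ?] /andP[? ?]; rewrite /lower /upper.
by case: (ler0P (x - z)) => ?; case: (ler0P (x - (1 - z))) => ?; lra.
Qed.

Lemma lower_eq_upper z x : z = 0 \/ z = 1 -> 0 <= x <= 1 ->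
    lower z x = upper z x.
Proof.
move=> z01 /andP[? ?]; rewrite /lower /upper.
by case: z01 => ->; case: (ler0P) => ?; case: (ler0P) => ?; lra.
Qed.

End Sides.

(** * Riemann sums for both kinds of permutons *)

Section StepIntegrals.
Variables (R : realType) (f : test_function R) (n : nat) (e : R).
Local Notation N := (n.+1%:R : R).
Local Notation leb := (@lebesgue_measure R).
Hypothesis fe : forall p q : R * R, `|p.1 - q.1| <= N^-1 -> `|p.2 - q.2|
    <= N^-1 ->
  `|extend f p - extend f q| <= e.

Let N0 : 0 < N. Proof. by rewrite ltr0n. Qed.

Let grid_inj (i j : 'I_n.+1) x : i%:R / N <= x < i.+1%:R / N ->
  j%:R / N <= x < j.+1%:R / N -> i = j.
Proof.
move=> /andP[ix xi] /andP[jx xj]; apply/val_inj/eqP => /=; rewrite eqn_leq.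
have := le_lt_trans ix xj; have := le_lt_trans jx xi.
by rewrite !ltr_pM2r ?invr_gt0// !ltr_nat !ltnS => -> ->.
Qed.

Let gridS (i : nat) : i.+1%:R / N - i%:R / N = N^-1.
Proof. by rewrite -mulrBl -natrB// subSnn mul1r. Qed.

Let grid01 (i : 'I_n.+1) : [/\ 0 <= i%:R / N, i%:R / N <= i.+1%:R / N & i.+1%:R
    / N <= 1].
Proof.
split; first by rewrite divr_ge0.
  by rewrite ler_pM2r ?invr_gt0// ler_nat.
by rewrite ler_pdivrMr// mul1r ler_nat.
Qed.

Let grid_dist (i : nat) x : i%:R / N <= x <= i.+1%:R / N -> `|x - i%:R / N|
    <= N^-1.
Proof.
move: (gridS i); move: (i%:R / N) (i.+1%:R / N) N^-1 => a b h ? /andP[? ?].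
by rewrite ler_norml; apply/andP; split; lra.
Qed.

(** Both graphs are 1-Lipschitz, so over one grid interval they stay within a grid step in each
    coordinate and [fe] applies. Each strip receives half the length of its interval. *)
Lemma rectangle_integral_step z (z01 : 0 <= z <= 1) :
  `|permuton_integral (rectangle_permuton z01) f -
    \sum_(i < n.+1) (extend f (i%:R / N, lower z (i%:R / N)) +
      extend f (i%:R / N, upper z (i%:R / N))) * (2^-1 * N^-1)| <= e.
Proof.
have [M HM] := extend_bounded f.
pose mu := rectangle_permuton z01.
have muT := probability_setT mu.
have cl := lipschitz_continuous (lower_lipschitz z).
have cu := lipschitz_continuous (upper_lipschitz z).
pose B (b : bool) (i : 'I_n.+1) := strip (if b then lower z else upper z) (i%:R
  / N) (i.+1%:R / N).
have mB b i : measurable (B b i) by apply: measurable_strip; case: b.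
have Bl i : ((2^-1 * N^-1)%:E <= segment_measure (side1 z) (B true i) +
  segment_measure (side3 z) (B true i))%E.
  by have [? ? ?] := grid01 i; rewrite -(gridS i) rectangle_strip_lower.
have Bu i : ((2^-1 * N^-1)%:E <= segment_measure (side2 z) (B false i) +
  segment_measure (side4 z) (B false i))%E.
  by have [? ? ?] := grid01 i; rewrite -(gridS i) rectangle_strip_upper.
have seg0 p q S : (0 <= segment_measure (R := R) (segment p q) S)%E.
  by rewrite /segment_measure mule_ge0 ?lee_fin ?invr_ge0.
have muE S : (mu S = (segment_measure (side1 z) S + segment_measure (side3 z) S)
  +
    (segment_measure (side2 z) S + segment_measure (side4 z) S))%E.
  by rewrite addeACA addeA.
have fB b i p : B b i p -> `|extend f p - extend f (i%:R / N,
  (if b then lower z else upper z) (i%:R / N))| <= e.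
  move=> [/andP[p1 p2] p3]; apply: fe => /=.
    by apply: grid_dist; rewrite !ltW.
  rewrite p3; apply: le_trans (_ : `|p.1 - i%:R / N| <= _).
    by case: b {p3}; [exact: lower_lipschitz|exact: upper_lipschitz].
  by apply: grid_dist; rewrite !ltW.
have Bi b b' i j p : B b i p -> B b' j p -> i = j.
  move=> [/andP[p1 p2] _] [/andP[q1 q2] _].
  by apply: (@grid_inj _ _ p.1); rewrite ?p2 ?q2 andbT ltW.
rewrite permuton_integralE.
have sumN (c : R) : \sum_(i < n.+1) c * N^-1 = c.
  by rewrite sumr_const card_ord -[LHS]mulr_natr mulfVK// gt_eqF.
have [z0|z0] := boolP (0 < z < 1).
  pose c (j : bool * 'I_n.+1) := extend f (j.2%:R / N,
    (if j.1 then lower z else upper z) (j.2%:R / N)).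
  have -> : \sum_(i < n.+1) (extend f (i%:R / N, lower z (i%:R / N)) +
      extend f (i%:R / N, upper z (i%:R / N))) * (2^-1 * N^-1) =
      \sum_j c j * (2^-1 * N^-1).
    rewrite -(pair_bigA _ (fun b i => c (b, i) * (2^-1 * N^-1)))/= big_bool
      -big_split/=.
    by apply: eq_bigr => i _; rewrite mulrDl.
  apply: (@Rintegral_step _ _ _ mu setT measurableT muT _ (fun j => B j.1 j.2) c
      (fun=> 2^-1 * N^-1) _ M) => //.
  - exact: extend_measurable.
  - move=> [b i] [b' j] p /= Bp Bp'; have ij := Bi _ _ _ _ _ Bp Bp'; subst j.
    have [g0 _ g1] := grid01 i; case: Bp Bp' => /andP[p1 p2] p3 [_ p3'].
    have p01 : 0 < p.1 < 1 by rewrite (le_lt_trans g0 p1) (lt_le_trans p2 g1).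
    have := lower_lt_upper z0 p01.
    by case: b b' p3 p3' => -[] //= <- <-; rewrite ltxx.
  - by move=> [b i] p _; exact: fB.
  - move=> [[] i] /=; rewrite setIT muE.
      by apply: le_trans (Bl i) _; rewrite leeDl// adde_ge0//; exact: seg0.
    by apply: le_trans (Bu i) _; rewrite leeDr// adde_ge0//; exact: seg0.
  - rewrite -(pair_bigA _ (fun _ _ => 2^-1 * N^-1))/= big_bool/= !sumN; lra.
(* the lower and the upper sides coincide: each strip is used once *)
have zE : z = 0 \/ z = 1.
  have /andP[z1 z2] := z01; move: z0;
    rewrite !lt_neqAle z1 z2 !andbT negb_and !negbK.
  by case/orP => /eqP; [left|right].
pose c (i : 'I_n.+1) := extend f (i%:R / N, lower z (i%:R / N)).
have lu (i : 'I_n.+1) x : i%:R / N <= x <= i.+1%:R / N -> upper z x = lower z x.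
  move=> /andP[p1 p2]; have [g0 _ g1] := grid01 i; apply/esym/lower_eq_upper =>
    //.
  by rewrite (le_trans g0 p1) (le_trans p2 g1).
have -> : \sum_(i < n.+1) (extend f (i%:R / N, lower z (i%:R / N)) +
      extend f (i%:R / N, upper z (i%:R / N))) * (2^-1 * N^-1) = \sum_i c i *
        N^-1.
  apply: eq_bigr => i _; rewrite (lu i) ?lexx//; last by have [] := grid01 i.
  rewrite -/(c i); by field; rewrite gt_eqF.
apply: (@Rintegral_step _ _ _ mu setT measurableT muT _ (B true) c (fun=>
  N^-1) _ M) => //.
- exact: extend_measurable.
- exact: Bi.
- by move=> i p _; exact: fB.
- move=> i /=; rewrite setIT muE.
  have BE : B true i = B false i.
    apply/seteqP; split=> p [p12 pE]; split=> //; rewrite pE; have /andP[? ?] :=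
      p12;
    by rewrite (lu i)// !ltW.
  have -> : (N^-1)%:E = ((2^-1 * N^-1)%:E + (2^-1 * N^-1)%:E)%E.
    by rewrite -EFinD; congr EFin; field; rewrite gt_eqF.
  by apply: leeD; [exact: Bl|rewrite BE; exact: Bu].
- by rewrite -[RHS](sumN 1); apply: eq_bigr => i _; rewrite mul1r.
Qed.

Lemma perm_integral_step (s : 'S_n.+1) (c : 'I_n.+1 -> R * R) (w : R) :
  (forall (i : 'I_n.+1) (p : R * R), `|p.1 - i%:R / N| <= N^-1 ->
    `|p.2 - (s i)%:R / N| <= N^-1 ->
     `|extend f p - extend f (c i)| <= w) ->
  `|permuton_integral (perm_permuton R s) f - \sum_(i < n.+1) extend f (c i) *
    N^-1| <= w.
Proof.
move=> fw; have [M HM] := extend_bounded f.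
pose mu := perm_permuton R s.
have muT := probability_setT mu.
(* Making the cells half-open in the first coordinate already makes them disjoint, and their measure
   does not change. *)
pose B (i : 'I_n.+1) : set (plane R) := `[i%:R / N,
  i.+1%:R / N[ `*` `[(s i)%:R / N, (s i).+1%:R / N].
rewrite permuton_integralE.
apply: (@Rintegral_step _ _ _ mu setT measurableT muT _ B (fun i =>
  extend f (c i)) (fun=> N^-1) _ M) => //.
- exact: extend_measurable.
- by move=> i; apply: measurableX; exact: measurable_itv.
- move=> i j p [/= + _] [/= + _]; rewrite !in_itv/=; exact: grid_inj.
- move=> i p _ [/=]; rewrite !in_itv/= => /andP[l r] p2.
  by apply: fw; apply: grid_dist => //; rewrite l ltW.
- move=> i; rewrite setIT /= /perm_measure.
  have mcell j : measurable (@perm_cell R n s j) by apply: measurableX;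
    exact: measurable_itv.
  have mBi : measurable (B i) by apply: measurableX; exact: measurable_itv.
  rewrite (bigD1 i)//=.
  have -> : B i `&` @perm_cell R n s i = B i.
    by apply/setIidl => p [/= + p2]; rewrite /perm_cell !in_itv/= => /andP[? ?];
      split=> //=; rewrite in_itv/=; apply/andP; split=> //; exact: ltW.
  rewrite product_measure1E//; [|exact: measurable_itv..].
  have [? ? ?] := grid01 i.
  have len b j : leb [set` Interval (BSide true (j%:R / N)) (BSide b (j.+1%:R /
    N))] = (N^-1)%:E.
    rewrite lebesgue_measure_itv/= lte_fin ltr_pM2r ?invr_gt0// ltr_nat ltnSn.
    by rewrite -EFinB gridS.
  rewrite [X in (_ * (X + _))%E](_ : _ = (N^-1 * N^-1)%:E); last first.
    by rewrite EFinM; congr (_ * _)%E; exact: len.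
  apply: le_trans (_ : (N%:E * (N^-1 * N^-1)%:E <= _)%E).
    by rewrite -EFinM mulrA divff ?mul1r// gt_eqF.
  by rewrite lee_pmul2l ?lte_fin// leeDl// sume_ge0.
- by rewrite sumr_const card_ord -[LHS]mulr_natr mulVf// gt_eqF.
Qed.

End StepIntegrals.

(** * The curve of rectangle permutons *)

Section RectanglePath.
Variable R : realType.
Implicit Types (t u : R) (f : test_function R) (mu nu : permuton R).

(** Clamping makes the curve a function on the whole line, free of range proofs, whose continuity
    can be stated. *)
Definition rectangle_path t : permuton R := rectangle_permuton (clamp01 t).

Lemma rectangle_pathE t (t01 : 0 <= t <= 1) : rectangle_permuton t01 =
    rectangle_path t.
Proof.
rewrite /rectangle_path; move: (clamp01 t); rewrite clamp_id// => t01'.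
by congr rectangle_permuton; exact: bool_irrelevance.
Qed.

Local Notation I := permuton_integral.

(** Both integrals are compared with Riemann sums on one common grid, where a change of parameter
    moves each height by at most as much. *)
Lemma rectangle_path_uniform f (e : R) : 0 < e -> exists2 dl, 0 < dl &
  forall t u, `|t - u| <= dl -> `|I (rectangle_path t) f - I (rectangle_path u)
    f| <= e.
Proof.
move=> e0; have e3 : 0 < e / 3 by rewrite divr_gt0.
have [dl dl0 Hdl] := extend_uniform f e3.
have [n nd] : exists n : nat, n.+1%:R^-1 <= dl.
  exists (Num.truncn dl^-1); rewrite invf_ple ?posrE ?ltr0n// ltW//.
  by rewrite truncnS_gt.
exists dl => // t u tu.
have fe (p q : R * R) : `|p.1 - q.1| <= n.+1%:R^-1 -> `|p.2 - q.2|
  <= n.+1%:R^-1 ->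
    `|extend f p - extend f q| <= e / 3.
  by move=> h1 h2; apply: Hdl; [exact: le_trans h1 nd|exact: le_trans h2 nd].
have := rectangle_integral_step fe (clamp01 t).
have := rectangle_integral_step fe (clamp01 u).
set Su := \sum_(i < n.+1) _; set St := \sum_(i < n.+1) _ => Hu Ht.
suff H : `|Su - St| <= e / 3.
  apply: le_trans (ler_distD St _ _) _; have -> : e = e / 3 + (e / 3 +
    e / 3) by lra.
  apply: lerD => //; apply: le_trans (ler_distD Su _ _) _.
  by apply: lerD; rewrite distrC.
rewrite /Su /St -sumrB; apply: le_trans (ler_norm_sum _ _ _) _.
apply: le_trans (_ : \sum_(i < n.+1) e / 3 / n.+1%:R <= _); last first.
  by rewrite sumr_const card_ord -[leLHS]mulr_natr mulfVK// pnatr_eq0.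
have cut : `|clamp u - clamp t| <= dl.
  by rewrite (le_trans (clamp_lipschitz _ _))// distrC.
apply: ler_sum => i _; rewrite -mulrBl normrM [X in _ * X]ger0_norm; last first.
  by rewrite mulr_ge0 ?invr_ge0.
rewrite mulrA ler_wpM2r ?invr_ge0//.
set x := i%:R / _.
have H1 : `|extend f (x, lower (clamp u) x) - extend f (x, lower (clamp t) x)|
  <= e / 3.
  apply: Hdl => /=; first by rewrite subrr normr0 ltW.
  apply: le_trans cut; rewrite /lower; apply: le_trans (ler_dist_dist _ _) _.
  by rewrite (_ : _ - _ - _ = - (clamp u - clamp t)) ?normrN//; ring.
have H2 : `|extend f (x, upper (clamp u) x) - extend f (x, upper (clamp t) x)|
  <= e / 3.
  apply: Hdl => /=; first by rewrite subrr normr0 ltW.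
  apply: le_trans cut; rewrite /upper.
  have -> (a b : R) : 1 - a - (1 - b) = b - a by ring.
  apply: le_trans (ler_dist_dist _ _) _.
  by rewrite (_ : _ - _ - _ = - (clamp u - clamp t)) ?normrN//; ring.
move: H1 H2; set a := extend f _; set b := extend f _; set c := extend f _;
  set d := extend f _.
have -> : a + c - (b + d) = (a - b) + (c - d) by ring.
by move=> H1 H2; have := ler_normD (a - b) (c - d); lra.
Qed.

Lemma integral_path_continuous f : continuous (fun t => I (rectangle_path t) f).
Proof.
move=> t; apply/cvgrPdist_le => e e0.
have [dl dl0 H] := rectangle_path_uniform f e0.
near=> u; apply: H; rewrite ltW//; near: u; exact: cvgr_dist_lt.
Unshelve. all: by end_near. Qed.

Lemma integral_path_near (F : seq (test_function R)) t (dl : R) : 0 < dl ->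
  \forall u \near t, forall f, List.In f F ->
    `|I (rectangle_path u) f - I (rectangle_path t) f| < dl.
Proof.
move=> dl0; elim: F => [|f F IH]; first by apply/nbhs_ballP;
  exists 1 => //= u _ f [].
have H : \forall u \near t, `|I (rectangle_path u) f - I (rectangle_path t) f|
  < dl.
  have /cvgrPdist_lt/(_ _ dl0) := @integral_path_continuous f t.
  by apply: filterS => u; rewrite distrC.
by apply: filterS2 H IH => u Hf IHu g /= [<-//|]; exact: IHu.
Qed.

Lemma permuton_cvg (G : set_system (permuton R)) mu : Filter G ->
  (forall f, (fun nu => I nu f) @ G --> I mu f) -> G --> mu.
Proof.
move=> FG H A [U [[B oB <-] /= Bmu] BA].
have : (@permuton_integral R @ G) --> (permuton_integral mu : {ptws
  test_function R -> R}).
  apply/cvg_sup => f A' [W' [[C oC <-] /= Cf] CA].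
  apply: filterS CA _; apply: (H f C).
  by apply: open_nbhs_nbhs; split.
move=> /(_ B) HB; apply: filterS BA _; apply: HB.
by apply: open_nbhs_nbhs; split.
Qed.

Lemma rectangle_path_continuous : continuous rectangle_path.
Proof.
move=> t; apply: permuton_cvg => f.
exact: integral_path_continuous.
Qed.

(** The filter generated by the conditions on finitely many integrals converges to [mu], by
    [permuton_cvg]; every neighbourhood therefore contains one of its basic sets. *)
Lemma permuton_integral_nbhs mu (A : set (permuton R)) : nbhs mu A ->
  exists F : seq (test_function R), exists2 dl : R, 0 < dl &
    forall nu, (forall f, List.In f F -> `|I nu f - I mu f| < dl) -> A nu.
Proof.
pose base (q : seq (test_function R) * R) : set (permuton R) :=
  [set nu | forall f, List.In f q.1 -> `|I nu f - I mu f| < q.2].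
pose G := filter_from [set q : seq (test_function R) * R | 0 < q.2] base.
have FG : Filter G.
  apply: filter_from_filter; first by exists ([::], 1) => /=.
  move=> [F1 d1] [F2 d2] /= d10 d20; exists (F1 ++ F2, Num.min d1 d2) => /=.
    by rewrite lt_min d10.
  move=> nu /= H; split=> f fF /=.
    apply: lt_le_trans (H f _) _; last by rewrite ge_min lexx.
    by apply: List.in_or_app; left.
  apply: lt_le_trans (H f _) _; last by rewrite ge_min lexx orbT.
  by apply: List.in_or_app; right.
have Gmu : G --> mu.
  apply: permuton_cvg => f; apply/cvgrPdist_lt => e e0.
  exists ([:: f], e) => //= nu /(_ f (or_introl erefl)).
  by rewrite distrC.
by move=> /Gmu[[F dl] /= dl0 FA]; exists F, dl.
Qed.

Lemma phi_path_near (phi : permuton R -> R) (F : seq (test_function R)) t (e dl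
    : R) :
  continuous phi -> 0 < e -> 0 < dl ->
  \forall u \near t, `|phi (rectangle_path u) - phi (rectangle_path t)| < e /\
    forall f, List.In f F -> `|I (rectangle_path u) f - I (rectangle_path t) f|
      < dl.
Proof.
move=> cphi e0 dl0.
have nA : nbhs (rectangle_path t) [set nu | `|phi nu - phi (rectangle_path t)|
  < e].
  have /cvgrPdist_lt/(_ _ e0) := cphi (rectangle_path t).
  by apply: filterS => nu; rewrite distrC.
have H : \forall u \near t, `|phi (rectangle_path u) - phi (rectangle_path t)|
  < e.
  exact: (@rectangle_path_continuous t _ nA).
by apply: filterS2 H (integral_path_near F t dl0) => u h1 h2; split.
Qed.

(** Compactness of the curve is used as [near_covering] along the filter of
    growing finite families of test functions and shrinking tolerances. *)
Lemma uniform_on_path (phi : permuton R -> R) (e : R) : continuous phi ->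
    0 < e ->
  exists F : seq (test_function R), exists2 dl : R, 0 < dl &
    forall t nu, (forall f, List.In f F -> `|I nu f - I (rectangle_path t) f|
      <= dl) ->
      `|phi nu - phi (rectangle_path t)| <= e.
Proof.
move=> cphi e0; have e2 : 0 < e / 2 by rewrite divr_gt0.
pose P (q : seq (test_function R) * R) t := forall nu,
  (forall f, List.In f q.1 -> `|I nu f - I (rectangle_path t) f| <= q.2) ->
      `|phi nu - phi (rectangle_path t)| <= e.
pose base (q : seq (test_function R) * R) : set (seq (test_function R) * R) :=
  [set p | (forall f, List.In f q.1 -> List.In f p.1) /\ p.2 <= q.2].
pose G := filter_from [set q : seq (test_function R) * R | 0 < q.2] base.
have FG : Filter G.
  apply: filter_from_filter; first by exists ([::], 1) => /=.
  move=> [F1 d1] [F2 d2] /= d10 d20; exists (F1 ++ F2, Num.min d1 d2) => /=.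
    by rewrite lt_min d10.
  move=> [F dl] /= [H]; rewrite le_min => /andP[? ?]; split; split=> //= f fF.
    by apply: H; apply: List.in_or_app; left.
  by apply: H; apply: List.in_or_app; right.
have : \forall q \near G, `[0, 1] `<=` P q.
  apply: ((compact_near_coveringP _).1 (@segment_compact R 0 1)) => t _.
  have nA : nbhs (rectangle_path t) [set nu | `|phi nu - phi (rectangle_path t)|
    < e / 2].
    have /cvgrPdist_lt/(_ _ e2) := cphi (rectangle_path t).
    by apply: filterS => nu; rewrite distrC.
  have [F [dl dl0 HF]] := permuton_integral_nbhs nA.
  have dl2 : 0 < dl / 2 by rewrite divr_gt0.
  have dl32 : dl / 3 <= dl / 2 by lra.
  (* Integrals within [dl / 3] of those at [u], themselves within [dl / 2] of those at [t], are
     within [dl] of those at [t]. The two halves of [e] pay for the passage through the value of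
     [phi] at [t]. *)
  exists ([set u | `|phi (rectangle_path u) - phi (rectangle_path t)| < e / 2 /\
     forall f, List.In f F -> `|I (rectangle_path u) f - I (rectangle_path t) f|
       < dl / 2],
     base (F, dl / 3)); first split=> /=.
  - exact: phi_path_near.
  - by exists (F, dl / 3) => //=; rewrite divr_gt0.
  - move=> [u [F' d']] [/= [pu Iu] [FF dd]] nu Hnu.
    have H : `|phi nu - phi (rectangle_path t)| < e / 2.
      apply: HF => f fF; apply: le_lt_trans (ler_distD (I (rectangle_path u) f)
        _ _) _.
      have -> : dl = dl / 2 + dl / 2 by lra.
      apply: ler_ltD (Iu f fF); apply: le_trans (Hnu f (FF f fF)) _ => /=.
      exact: le_trans dd dl32.
    apply: le_trans (ler_distD (phi (rectangle_path t)) _ _) _.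
    have -> : e = e / 2 + e / 2 by lra.
    by apply: lerD; apply: ltW => //; rewrite distrC.
move=> [[F dl] /= dl0 HP]; exists F, dl => // t nu H.
have : P (F, dl) (clamp t) by apply: HP; [split|rewrite /= in_itv/= clamp01].
have E : rectangle_path (clamp t) = rectangle_path t.
  by rewrite -(rectangle_pathE (clamp01 t)).
by move=> /(_ nu); rewrite E; apply.
Unshelve. all: by end_near. Qed.

Lemma path_phi_uniform (phi : permuton R -> R) (e : R) : continuous phi ->
    0 < e ->
  exists2 dl : R, 0 < dl & forall t u, `|t - u| <= dl ->
    `|phi (rectangle_path t) - phi (rectangle_path u)| <= e.
Proof.
move=> cphi e0; have [F [d d0 H]] := uniform_on_path cphi e0.
suff [dl dl0 Hdl] : exists2 dl, 0 < dl & forall t u, `|t - u| <= dl ->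
    forall f, List.In f F -> `|I (rectangle_path t) f - I (rectangle_path u) f|
      <= d.
  by exists dl => // t u tu; apply: H; exact: Hdl.
elim: F {H} => [|f F [dl dl0 IH]]; first by exists 1.
have [dl' dl'0 H'] := rectangle_path_uniform f d0.
exists (Num.min dl dl'); first by rewrite lt_min dl0.
move=> t u; rewrite le_min => /andP[h1 h2] g /= [<-|gF]; first exact: H'.
exact: IH.
Qed.

End RectanglePath.

(** * Sums over square permutations *)

Section CloseToPath.
Variables (R : realType) (f : test_function R).
Local Notation I := permuton_integral.

(** The mean of [f] over the points is the mean over both sides plus the mean of
    the gaps, signed by the labels of the positions. *)
Definition height_gap (n : nat) (t : R) (i : nat) : R :=
  (extend f (i%:R / n.+1%:R, lower t (i%:R / n.+1%:R)) -
   extend f (i%:R / n.+1%:R, upper t (i%:R / n.+1%:R))) / 2.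

Lemma natr_dist (i j : nat) : ((i - j) + (j - i))%N%:R = `|i%:R - j%:R| :> R.
Proof.
have [ij|/ltnW ji] := leqP i j.
  rewrite (eqP (_ : i - j == 0)%N) ?subn_eq0// add0n natrB//.
  by rewrite ler0_norm ?opprB// subr_le0 ler_nat.
rewrite (eqP (_ : j - i == 0)%N) ?subn_eq0// addn0 natrB//.
by rewrite ger0_norm// subr_ge0 ler_nat.
Qed.

Section Deterministic.
Variables (n a : nat) (s : 'S_n.+1) (z : 'I_n.+1) (dl e : R).
Local Notation N := (n.+1%:R : R).
Hypothesis near_s : near_sides a s z.
Hypothesis fe : forall p q : R * R, `|p.1 - q.1| <= dl -> `|p.2 - q.2| <= dl ->
  `|extend f p - extend f q| <= e.
Hypothesis adl : a.+1%:R / N <= dl.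

Let N0 : 0 < N. Proof. by rewrite ltr0n. Qed.

Let Ndl : N^-1 <= dl.
Proof. by apply: (le_trans _ adl); rewrite ler_peMl ?ler1n// invr_ge0 ltW. Qed.

Lemma near_sides_line (i : 'I_n.+1) :
  `|(s i)%:R / N - (if low s i then lower (z%:R / N) (i%:R / N)
     else upper (z%:R / N) (i%:R / N))| <= a%:R / N.
Proof.
have iN : 0 <= N^-1 by rewrite invr_ge0 ltW.
have := near_s i; case: (low s i) => -[h1 h2].
  rewrite /lower -mulrBl normrM (ger0_norm iN) -mulrBl normrM (ger0_norm iN).
  rewrite ler_wpM2r// -natr_dist; move: h1 h2; rewrite -!(ler_nat R) !natrD =>
    h1 h2.
  by rewrite ler_norml; apply/andP; split; lra.
have -> : upper (z%:R / N) (i%:R / N) = (N - `|(i + z)%N%:R - N|) / N.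
  rewrite /upper mulrBl divff ?gt_eqF// natrD; congr (_ - _).
  rewrite -[X in _ = _ * X](ger0_norm iN) -normrM; congr (`|_|).
  by field; rewrite gt_eqF.
rewrite -mulrBl normrM (ger0_norm iN) ler_wpM2r// -natr_dist.
move: h1 h2; rewrite -!(ler_nat R) ![(s i + _)%N%:R]natrD ![(n.+1 +
  _)%N%:R]natrD.
rewrite [(s i + _ + a)%N%:R]natrD [(s i + _)%N%:R]natrD.
move: ((i + z - n.+1 + (n.+1 - (i + z)))%N%:R) (n.+1%:R) => u v h1 h2.
by rewrite ler_norml; apply/andP; split; lra.
Qed.

(** The three errors come from moving every point onto its side, from the Riemann sum for the
    rectangle, and from the unequal use of the two sides, which is the signed sum. *)
Lemma near_close : `|signed_sum (height_gap n (z%:R / N)) (code s).1 n.+1|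
    <= e * N ->
  `|I (perm_permuton R s) f - I (rectangle_path (z%:R / N)) f| <= e + e + e.
Proof.
move=> W.
have z01 : 0 <= z%:R / N <= 1.
  by rewrite divr_ge0//= ler_pdivrMr// mul1r ler_nat ltnW.
pose c (i : 'I_n.+1) := (i%:R / N, if low s i then lower (z%:R / N) (i%:R / N)
     else upper (z%:R / N) (i%:R / N)).
have H1 : `|I (perm_permuton R s) f - \sum_(i < n.+1) extend f (c i) * N^-1|
  <= e.
  apply: perm_integral_step => i p p1 p2; apply: fe;
    first exact: le_trans p1 Ndl.
  apply: (le_trans _ adl); rewrite -natr1 mulrDl mul1r [leRHS]addrC.
  apply: le_trans (ler_distD ((s i)%:R / N) _ _) _.
  by apply: lerD => //; exact: near_sides_line.
have fN (p q : R * R) : `|p.1 - q.1| <= N^-1 -> `|p.2 - q.2| <= N^-1 ->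
    `|extend f p - extend f q| <= e.
  by move=> h1 h2; apply: fe; [exact: le_trans h1 Ndl|exact: le_trans h2 Ndl].
have H2 := rectangle_integral_step fN z01.
rewrite rectangle_pathE in H2.
have E : \sum_(i < n.+1) extend f (c i) * N^-1 =
    \sum_(i < n.+1) (extend f (i%:R / N, lower (z%:R / N) (i%:R / N)) +
      extend f (i%:R / N, upper (z%:R / N) (i%:R / N))) * (2^-1 * N^-1) +
    signed_sum (height_gap n (z%:R / N)) (code s).1 n.+1 / N.
  rewrite /signed_sum mulr_suml -big_split/=; apply: eq_bigr => i _.
  rewrite onatE ffunE /height_gap /c /sgn.
  by case: (low s i); field; rewrite gt_eqF.
have H3 : `|signed_sum (height_gap n (z%:R / N)) (code s).1 n.+1 / N| <= e.
  rewrite normrM [`|N^-1|]ger0_norm; last by rewrite invr_ge0 ltW.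
  by rewrite ler_pdivrMr.
move: H1 H2 H3; rewrite E.
move: (\sum_(i < n.+1) _) (signed_sum _ _ _ / N) (I (perm_permuton R s) f) (I
  (rectangle_path _) f) => A B u v.
move=> H1 H2 H3.
have -> : u - v = (u - (A + B)) + B + (A - v) by ring.
apply: le_trans (ler_normD _ _) _; apply: lerD; last by rewrite distrC.
by apply: le_trans (ler_normD _ _) _; apply: lerD.
Qed.

End Deterministic.

Lemma height_gap_le (M : R) : (forall p, `|extend f p| <= M) ->
  forall n t i, `|height_gap n t i| <= M.
Proof.
move=> fM n t i; rewrite /height_gap normrM [`|2^-1|]ger0_norm// ler_pdivrMr//.
apply: le_trans (ler_normB _ _) _; rewrite mulr_natr mulr2n.
by apply: lerD.
Qed.

Lemma nwords4 n : (1 < n)%N -> 2 ^+ n.+1 * 2 ^+ n.+1 = 32 * (nwords n)%:R :> R.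
Proof.
move=> n1; rewrite /nwords natrM !natrX.
have [k ->] : exists k, n = k.+2 by exists n.-2; lia.
by rewrite subn2 subn1 /= !exprS; ring.
Qed.

Lemma card_close (e b w : R) : 0 < e -> 0 < b -> 0 < w ->
  exists K : R, forall n (z : 'I_n.+1), K <= n.+1%:R ->
    b * n.+1%:R <= z%:R -> b * n.+1%:R <= n.+1%:R - z%:R ->
    (nwords n)%:R <= #|[set s in Sq_at z |
       `|I (perm_permuton R s) f - I (rectangle_path (z%:R / n.+1%:R)) f|
         <= e]%SET|%:R
      + w * (nwords n)%:R.
Proof.
move=> e0 b0 w0; have e3 : 0 < e / 3 by rewrite divr_gt0.
have [dl dl0 Hdl] := extend_uniform f e3.
have [M HM] := extend_bounded f.
(* The imbalance [a] will be about [d * N]. The first bound puts [6 * a + 12] below the margin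
   [b * N], the second puts [9 * a + 10] below [dl * N]. *)
pose d := Num.min (b / 12) (dl / 18).
have d0 : 0 < d by rewrite lt_min !divr_gt0.
have db : 12 * d <= b by have := ge_min (b / 12) (b / 12) (dl / 18);
  rewrite lexx -/d; lra.
have ddl : 18 * d <= dl.
  by have := ge_min (dl / 18) (b / 12) (dl / 18); rewrite lexx orbT -/d; lra.
(* [C / N] bounds the proportion of exceptional codes: the first term for two unbalanced words, with
   [n.+2 <= 2 * N] and [a >= d * N / 2], the second for a large signed sum. *)
pose C := 3 * 2 ^+ 3 * 2 / (d / 2) ^+ 4 + M ^+ 2 / (e / 3) ^+ 2.
have C0 : 0 <= C.
  have d2 : 0 < d / 2 by rewrite divr_gt0.
  have c0 : 0 <= 3 * 2 ^+ 3 * 2 :> R by rewrite -natrX -!natrM ler0n.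
  exact: addr_ge0 (divr_ge0 c0 (exprn_ge0 _ (ltW d2))) (divr_ge0 (sqr_ge0 _)
    (sqr_ge0 _)).
(* The first two terms absorb the additive constants [12] and [10], the third gives
   [a >= d * N / 2], the fourth [32 * C / N <= w], and the last [1 < n]. *)
exists (25 / b + 20 / dl + 2 / d + 32 * C / w + 3) => n z NK zb zbN.
pose N : R := n.+1%:R.
have N0 : 0 < N by rewrite ltr0n.
have [k1 k2 k3 k4] : [/\ 0 <= 25 / b, 0 <= 20 / dl, 0 <= 2 / d & 0 <= 32 *
  C / w].
  by split; apply: divr_ge0 => //; rewrite ?mulr_ge0//; exact: ltW.
have Nb : 25 <= b * N by rewrite mulrC -ler_pdivrMr//; move: NK; rewrite -/N;
  lra.
have Ndl : 20 <= dl * N by rewrite mulrC -ler_pdivrMr//; move: NK; rewrite -/N;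
  lra.
have Nd : 2 <= d * N by rewrite mulrC -ler_pdivrMr//; move: NK; rewrite -/N;
  lra.
have NC : 32 * C <= w * N by rewrite mulrC [w * N]mulrC -ler_pdivrMr//;
  move: NK; rewrite -/N [C * 32]mulrC; lra.
have n1 : (1 < n)%N.
  by rewrite -ltnS -(ltr_nat R); move: NK; lra.
pose a := Num.truncn (d * N).
have dN0 : 0 <= d * N by rewrite mulr_ge0 ?ltW.
have aN : a%:R <= d * N by rewrite truncn_le.
have Na : d * N < a%:R + 1 by rewrite natr1 truncnS_gt.
have a2 : d / 2 * N <= a%:R by move: Nd Na; lra.
have dbN : 12 * (d * N) <= b * N by rewrite mulrA ler_wpM2r// ltW.
have ddlN : 18 * (d * N) <= dl * N by rewrite mulrA ler_wpM2r// ltW.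
have az : (6 * a + 12 < z)%N.
  by rewrite -(ltr_nat R) natrD natrM; move: zb; rewrite -/N; lra.
have azN : (6 * a + 12 < n.+1 - z)%N.
  by rewrite -(ltr_nat R) natrD natrM natrB 1?ltnW//; move: zbN; rewrite -/N;
    lra.
have adl : (9 * a + 9).+1%:R / N <= dl.
  by rewrite ler_pdivrMr// -natr1 natrD natrM; lra.
pose E : pred {ffun 'I_n.+1 -> bool} := fun x =>
  `|signed_sum (height_gap n (z%:R / N)) x n.+1| <= e / 3 * N.
have zint : (0 < z < n)%N.
  apply/andP; split; first by apply: leq_ltn_trans az.
  have : (1 < n.+1 - z)%N by apply: leq_ltn_trans azN; rewrite addnS.
  by rewrite ltn_subRL addn1 ltnS.
have := card_near E az azN; rewrite card_anchored//.
rewrite -(ler_nat R) natrD => H.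
apply: (le_trans H); apply: lerD.
  rewrite ler_nat; apply: subset_leq_card; apply/fintype.subsetP => s;
    rewrite !inE.
  move=> /andP[-> /andP[Es /asboolP ns]] /=.
  have -> : e = e / 3 + e / 3 + e / 3 by lra.
  exact: near_close ns Hdl adl Es.
rewrite natrM natrX natrD natrM.
set B := #|_|%:R; set B' := #|_|%:R.
have BB : B * a%:R ^+ 4 <= (3 * n.+2%:R ^+ 3) * 2 ^+ n.+1 by exact:
  card_unbalanced.
have BB' : B' * (e / 3 * N) ^+ 2 <= N * M ^+ 2 * 2 ^+ n.+1.
  rewrite /B' (_ : [set x | ~~ E x]%SET =
     [set x | e / 3 * N < `|signed_sum (height_gap n (z%:R / N)) x n.+1|]%SET);
       last first.
    by apply/setP => x; rewrite !inE -ltNge.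
  apply: (@card_large_signed R n (height_gap n (z%:R / N)) M (e / 3 * N)).
    exact: height_gap_le.
  by rewrite mulr_ge0 ?(ltW e3) ?(ltW N0).
set W : R := 2 ^+ n.+1; have W0 : 0 < W by rewrite exprn_gt0.
have BC : B * N <= 3 * 2 ^+ 3 / (d / 2) ^+ 4 * W.
  have h0 : 0 < (d / 2) ^+ 4 by rewrite exprn_gt0 ?divr_gt0.
  rewrite [leRHS]mulrAC ler_pdivlMr//.
  have h1 : B * (d / 2 * N) ^+ 4 <= 3 * (2 * N) ^+ 3 * W.
    apply: le_trans (_ : B * a%:R ^+ 4 <= _).
      by rewrite ler_wpM2l// lerXn2r ?nnegrE// mulr_ge0 ?divr_ge0 ?ltW.
    apply: (le_trans BB); rewrite ler_wpM2r ?(ltW W0)// ler_wpM2l// lerXn2r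
      ?nnegrE ?mulr_ge0 ?(ltW N0)//.
    by rewrite /N -natrM ler_nat mul2n -addnn -[n.+2]addn1 leq_add2l.
  rewrite -(ler_pM2r (exprn_gt0 3 N0)).
  rewrite [(d / 2 * N) ^+ 4]exprMn [(2 * N) ^+ 3]exprMn in h1.
  have -> : B * N * (d / 2) ^+ 4 * N ^+ 3 = B * ((d / 2) ^+ 4 * N ^+
    4) by rewrite [N ^+ 4]exprS; ring.
  have -> : 3 * 2 ^+ 3 * W * N ^+ 3 = 3 * (2 ^+ 3 * N ^+ 3) * W by ring.
  exact: h1.
have BC' : B' * N <= M ^+ 2 / (e / 3) ^+ 2 * W.
  have h0 : 0 < (e / 3) ^+ 2 by rewrite exprn_gt0.
  rewrite [leRHS]mulrAC ler_pdivlMr// -(ler_pM2r N0).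
  have -> : B' * N * (e / 3) ^+ 2 * N = B' * (e / 3 * N) ^+ 2 by ring.
  by have -> : M ^+ 2 * W * N = N * M ^+ 2 * W by ring.
have T : (2 * B + B') * N <= C * W.
  have -> : (2 * B + B') * N = 2 * (B * N) + B' * N by ring.
  have -> : C * W = 2 * (3 * 2 ^+ 3 / (d / 2) ^+ 4 * W) + M ^+ 2 / (e / 3) ^+
    2 * W.
    by rewrite /C; move: ((d / 2) ^+ 4)^-1 ((e / 3) ^+ 2)^-1 => u v; ring.
  by apply: lerD => //; rewrite ler_pM2l.
rewrite -(ler_pM2r N0) -[leLHS]mulrA.
apply: le_trans (_ : W * (C * W) <= _); first by rewrite ler_wpM2l ?(ltW W0).
have -> : W * (C * W) = C * 32 * (nwords n)%:R by rewrite -mulrA -nwords4//;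
  rewrite -/W; ring.
have -> : w * (nwords n)%:R * N = w * N * (nwords n)%:R by ring.
by rewrite ler_wpM2r// mulrC.
Qed.

End CloseToPath.

Section SumOverSquare.
Variable R : realType.
Local Notation I := permuton_integral.
Local Notation path := (@rectangle_path R).

Lemma bulk_interior n (z : 'I_n.+1) (b : R) : 0 < b -> 3 / b + 3 <= n.+1%:R ->
  b * n.+1%:R <= z%:R -> b * n.+1%:R <= n.+1%:R - z%:R -> (0 < z < n)%N.
Proof.
move=> b0 N3 zb zbN.
have b3 : 0 <= 3 / b by apply: divr_ge0 => //; exact: ltW.
have bN : 3 <= b * n.+1%:R by rewrite mulrC -ler_pdivrMr//; lra.
apply/andP; split; first by rewrite -(ltr_nat R); lra.
rewrite -(ltr_nat R); move: zbN bN; rewrite -natr1; lra.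
Qed.

(** Two sets that nearly fill [Sq_at z], itself of size at most [nwords n], have an intersection
    that nearly does, by inclusion-exclusion; the allowances [w / 2] add up. *)
Lemma card_close_list (F : seq (test_function R)) (e b w : R) :
  0 < e -> 0 < b -> 0 < w ->
  exists K : R, forall n (z : 'I_n.+1), K <= n.+1%:R ->
    b * n.+1%:R <= z%:R -> b * n.+1%:R <= n.+1%:R - z%:R ->
    (nwords n)%:R <= #|[set s in Sq_at z | `[< forall f, List.In f F ->
       `|I (perm_permuton R s) f - I (path (z%:R / n.+1%:R)) f| <= e >]]%SET|%:R
      + w * (nwords n)%:R.
Proof.
move=> e0 b0; elim: F w => [|f F IH] w w0.
  (* For the empty family the zero test function serves: its instance of [card_close] bounds the
     size of [Sq_at z] itself from below. *)
  have c0 : {within @unit_square R, continuous (fun=> 0 : R)} by move=> x;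
    exact: cvg_cst.
  have [K HK] := card_close (exist _ (fun=> 0) c0 : test_function R) e0 b0 w0.
  exists K => n z NK zb zbN; apply: (le_trans (HK n z NK zb zbN)).
  rewrite lerD2r ler_nat; apply: subset_leq_card; apply/fintype.subsetP => s.
  by rewrite !inE => /andP[-> _]; apply/asboolP.
have w2 : 0 < w / 2 by rewrite divr_gt0.
have [K1 H1] := card_close f e0 b0 w2; have [K2 H2] := IH _ w2.
exists (Num.max K1 (Num.max K2 (3 / b + 3))) => n z; rewrite !ge_max =>
  /and3P[NK1 NK2 NK3] zb zbN.
have {}H1 := H1 n z NK1 zb zbN; have {}H2 := H2 n z NK2 zb zbN.
move: H1 H2; set A := [set s in _ | _]%SET; set B := [set s in _ | _]%SET =>
  H1 H2.
set C := [set s in _ | _]%SET.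
have zint := bulk_interior b0 NK3 zb zbN.
have Sn : (#|Sq_at z| <= nwords n)%N by rewrite -(card_anchored zint)
  card_Sq_at.
have AB : A :&: B \subset C.
  apply/fintype.subsetP => s; rewrite !inE => /andP[/andP[->
    h1] /andP[_ /asboolP h2]].
  by apply/asboolP => g /= [<-//|]; exact: h2.
have AUB : (#|A :|: B| <= nwords n)%N.
  apply: leq_trans Sn; apply: subset_leq_card; apply/fintype.subsetP => s.
  by rewrite !inE => /orP[] /andP[->].
have := cardsUI A B; have := subset_leq_card AB; move: AUB H1 H2.
rewrite -!(ler_nat R) => h0 h1 h2 h3 /(congr1 (fun k => k%:R : R));
  rewrite !natrD.
by move: h0 h1 h2 h3; clear; lra.
Qed.

Variables (phi : permuton R -> R) (M : R).
Hypotheses (cphi : continuous phi) (phiM : forall mu, `|phi mu| <= M).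

Let M0 : 0 <= M. Proof. exact: le_trans (phiM (path 0)). Qed.

Lemma sum_at_close (e b : R) : 0 < e -> 0 < b ->
  exists K : R, forall n (z : 'I_n.+1), K <= n.+1%:R ->
    b * n.+1%:R <= z%:R -> b * n.+1%:R <= n.+1%:R - z%:R ->
    `|\sum_(s in Sq_at z) phi (perm_permuton R s) -
      (nwords n)%:R * phi (path (z%:R / n.+1%:R))| <= e * (nwords n)%:R.
Proof.
move=> e0 b0; have e2 : 0 < e / 2 by rewrite divr_gt0.
have [F [dl dl0 HF]] := uniform_on_path cphi e2.
have M1 : 0 < 6 * M + 6 by move: M0; lra.
(* Exceptional permutations cost [2 * M] each and the deficit of [Sq_at z] costs [M]; [k] makes
   [3 * M * k] at most [e / 2]. The [+ 6] keeps the denominator positive when [M = 0]. *)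
pose k := e / (6 * M + 6); have k0 : 0 < k by rewrite divr_gt0.
have kE : k * (6 * M + 6) = e by rewrite mulfVK// gt_eqF.
have [K HK] := card_close_list F dl0 b0 k0.
exists (Num.max K (3 / b + 3)) => n z; rewrite ge_max => /andP[NK NK3] zb zbN.
have {}HK := HK n z NK zb zbN.
have zint := bulk_interior b0 NK3 zb zbN.
have Sn : (#|Sq_at z| <= nwords n)%N by rewrite -(card_anchored zint)
  card_Sq_at.
move: HK; set T := [set s in _ | _]%SET; set h := phi (path _) => HK.
have TS : T \subset Sq_at z by apply/fintype.subsetP => s; rewrite inE =>
  /andP[].
have TSn := subset_leq_card TS.
have -> : \sum_(s in Sq_at z) phi (perm_permuton R s) - (nwords n)%:R * h =
    \sum_(s in Sq_at z) (phi (perm_permuton R s) - h) + (#|Sq_at z|%:R - (nwords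
      n)%:R) * h.
  by rewrite sumrB sumr_const -[h *+ _]mulr_natl; ring.
apply: le_trans (ler_normD _ _) _.
have H1 : `|\sum_(s in Sq_at z) (phi (perm_permuton R s) - h)| <=
    #|T|%:R * (e / 2) + (#|Sq_at z|%:R - #|T|%:R) * (2 * M).
  apply: le_trans (ler_norm_sum _ _ _) _.
  rewrite (big_setID T)/= (finset.setIidPr TS); apply: lerD.
    rewrite [leRHS]mulr_natl -[leRHS]sumr_const; apply: ler_sum => s;
      rewrite inE => /andP[_ /asboolP H].
    exact: HF.
  have -> : #|Sq_at z|%:R - #|T|%:R = #|Sq_at z :\: T|%:R :> R.
    by rewrite -natrB// cardsD (finset.setIidPr TS).
  rewrite [leRHS]mulr_natl -[leRHS]sumr_const; apply: ler_sum => s _.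
  apply: le_trans (ler_normB _ _) _; rewrite mulr2n mulrDl !mul1r.
  by apply: lerD; exact: phiM.
have H2 : `|(#|Sq_at z|%:R - (nwords n)%:R) * h|
  <= ((nwords n)%:R - #|Sq_at z|%:R) * M.
  rewrite normrM ler0_norm ?opprB ?subr_le0 ?ler_nat// ler_wpM2l ?phiM//.
  by rewrite subr_ge0 ler_nat.
apply: le_trans (lerD H1 H2) _.
move: HK Sn TSn; rewrite -!(ler_nat R).
move: (#|T|%:R) (#|Sq_at z|%:R) ((nwords n)%:R) => t s w HK Sn TSn {H1 H2}.
have kw : w - t <= k * w by move: HK; clear; lra.
have t1 : t * (e / 2) <= w * (e / 2).
  by rewrite ler_wpM2r ?(ltW e2)//; exact: le_trans TSn Sn.
have t2 : (s - t) * (2 * M) <= k * w * (2 * M).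
  by rewrite ler_wpM2r ?mulr_ge0//; move: Sn kw; clear; lra.
have t3 : (w - s) * M <= k * w * M.
  by rewrite ler_wpM2r//; move: TSn kw; clear; lra.
have : e / 2 * w = 3 * M * (k * w) + 3 * (k * w) by rewrite -kE; field.
have kw0 : 0 <= k * w by apply: le_trans kw; rewrite subr_ge0;
  exact: le_trans TSn Sn.
have E2 : k * w * (2 * M) = 2 * (M * (k * w)) by ring.
have E3 : k * w * M = M * (k * w) by ring.
have -> : 3 * M * (k * w) = 3 * (M * (k * w)) by ring.
move: t1 t2 t3; rewrite E2 E3 => t1 t2 t3.
have Mkw : 0 <= M * (k * w) by rewrite mulr_ge0.
move: t1 t2 t3 kw0 Mkw; move: (k * w) (M * (k * w)) => q q' t1 t2 t3 q0 q0' E1.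
by move: t1 t2 t3 q0 q0' E1; clear; lra.
Qed.

Lemma card_ord_ltr n (c : R) : 0 <= c -> #|[set i : 'I_n.+1 |
    i%:R < c]%SET|%:R <= c + 1.
Proof.
move=> c0; apply: le_trans (_ : (Num.truncn c).+1%:R <= _); last first.
  by rewrite -natr1 lerD2r truncn_le.
rewrite ler_nat; have [kn|kn] := leqP (Num.truncn c).+1 n.+1.
  rewrite -[leqRHS](card_ord_lt kn); apply: subset_leq_card;
    apply/fintype.subsetP => i.
  rewrite !inE => ic; rewrite -(ltr_nat R); apply: lt_trans ic _.
  by rewrite truncnS_gt.
apply: leq_trans (ltnW kn); rewrite -[leqRHS](card_ord n.+1).
exact: max_card.
Qed.

Lemma card_not_bulk n (c : R) : 0 <= c ->
  \sum_(z < n.+1) (~~ ((c <= z%:R) && (c <= n.+1%:R - z%:R)))%:R <= 2 * (c + 1).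
Proof.
move=> c0; pose A := [set z : 'I_n.+1 | z%:R < c]%SET.
apply: le_trans (_ : #|A :|: (@rev_ord n.+1) @: A|%:R <= _).
  rewrite -natr_sum ler_nat -sum1_card [leqRHS]big_mkcond/=.
  apply: leq_sum => z _; rewrite negb_and -!ltNge.
  have [zA|zA] := ltP z%:R c; first by rewrite inE /A inE zA.
  rewrite /=; have [zB|//] := ltP (n.+1%:R - z%:R) c.
  rewrite (_ : z \in _ = true)// inE; apply/orP; right; apply/imsetP.
  exists (rev_ord z); last by rewrite rev_ordK.
  by rewrite inE /= natrB//; apply: le_lt_trans zB; rewrite lerB// ler_nat.
have cA := card_ord_ltr n c0.
have c1 := leq_card_setU A (@rev_ord n.+1 @: A).
have c2 := leq_imset_card (@rev_ord n.+1) A.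
apply: le_trans (_ : (#|A| + #|A|)%:R <= _).
  by rewrite ler_nat; apply: leq_trans c1 _; rewrite leq_add2l.
by rewrite natrD mulr_natl mulr2n lerD.
Qed.

Lemma sum_Sq_close (e : R) : 0 < e -> exists K : R, forall n, K <= n.+1%:R ->
  `|\sum_(s in Sq n.+1) phi (perm_permuton R s) -
    (nwords n)%:R * \sum_(z < n.+1) phi (path (z%:R / n.+1%:R))|
    <= e * (n.+1%:R * (nwords n)%:R).
Proof.
move=> e0; have e2 : 0 < e / 2 by rewrite divr_gt0.
have M1 : 0 < 24 * (M + 1) by move: M0; lra.
(* At most [2 * (b * N + 1)] positions lie outside the bulk, each with error at most [3 * M * W].
   The part in [b] is at most a quarter of [e * N * W] by this choice, and the constant part as well
   once [24 * M / e <= N]. *)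
pose b := e / (24 * (M + 1)); have b0 : 0 < b by rewrite divr_gt0.
have bE : b * (24 * (M + 1)) = e by rewrite /b mulfVK// gt_eqF.
have [K HK] := sum_at_close e2 b0.
exists (Num.max K (Num.max 3 (24 * M / e))) => n; rewrite !ge_max =>
  /and3P[NK N3 NM].
have n1 : (1 < n)%N by rewrite -ltnS -(ltr_nat R); move: N3; lra.
set N : R := n.+1%:R; set W : R := (nwords n)%:R.
have N0 : 0 < N by rewrite ltr0n.
have W0 : 0 <= W by rewrite ler0n.
have -> : \sum_(s in Sq n.+1) phi (perm_permuton R s) =
    \sum_(z < n.+1) \sum_(s in Sq_at z) phi (perm_permuton R s).
  rewrite (partition_big (@argmin n) predT)//=.
  by apply: eq_bigr => z _; apply: eq_bigl => s; rewrite !inE.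
rewrite mulr_sumr -sumrB; apply: le_trans (ler_norm_sum _ _ _) _.
pose bulk (z : 'I_n.+1) := (b * N <= z%:R) && (b * N <= N - z%:R).
have bound (z : 'I_n.+1) : `|\sum_(s in Sq_at z) phi (perm_permuton R s) -
    W * phi (path (z%:R / N))| <= (e / 2) * W + (~~ bulk z)%:R * (3 * M * W).
  have [/andP[z1 z2]|nb] := boolP (bulk z).
    by rewrite mul0r addr0; exact: HK.
  rewrite mul1r; apply: le_trans (_ : 3 * M * W <= _); last first.
    by rewrite lerDr mulr_ge0 ?(ltW e2).
  apply: le_trans (ler_normB _ _) _.
  have -> : 3 * M * W = (2 * W) * M + W * M by ring.
  apply: lerD; last by rewrite normrM (ger0_norm W0) ler_wpM2l.
  apply: le_trans (ler_norm_sum _ _ _) _.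
  apply: le_trans (_ : \sum_(s in Sq_at z) M <= _); first exact: ler_sum.
  rewrite sumr_const -[leLHS]mulr_natl ler_wpM2r// /W -natrM ler_nat.
  exact: leq_trans (card_Sq_at z) (card_anchored_le z n1).
apply: le_trans (ler_sum _ (fun z _ => bound z)) _.
rewrite big_split/= sumr_const card_ord -[_ *+ n.+1]mulr_natl -/N -mulr_suml.
have bN0 : 0 <= b * N by rewrite mulr_ge0 ?(ltW b0) ?(ltW N0).
have nbulk := card_not_bulk n bN0; rewrite -/N in nbulk.
have MW : 0 <= 3 * M * W by rewrite !mulr_ge0.
have H1 := ler_wpM2r MW nbulk.
have -> : e * (N * W) = N * (e / 2 * W) + e / 2 * (N * W) by field.
rewrite lerD2l; apply: (le_trans H1).
have -> : 2 * (b * N + 1) * (3 * M * W) = (6 * M * (b * N) + 6 * M) * W by ring.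
rewrite [leRHS]mulrA ler_wpM2r//.
have NM' : 24 * M <= e * N by rewrite [leRHS]mulrC -ler_pdivrMr.
have : e * N = 24 * (M * (b * N)) + 24 * (b * N) by rewrite -bE; ring.
have -> : 6 * M * (b * N) = 6 * (M * (b * N)) by ring.
have -> : e / 2 * N = (e * N) / 2 by ring.
have Mb : 0 <= M * (b * N) by rewrite mulr_ge0.
by move: NM' bN0 Mb; move: (e * N) (b * N) (M * (b * N)) => x y t; lra.
Qed.

End SumOverSquare.

(** * Convergence in distribution *)

Section FiniteValued.
Context (d : measure_display) (Om : measurableType d) (R : realType).
Variables (P : probability Om R) (T : finType) (X : Om -> T) (A : {set T}).
Hypothesis unifX : uniform_random P X A.

Lemma finite_valued_measurable (d' : measure_display) (S : measurableType d') (g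
    : T -> S) :
  measurable_fun [set: Om] (fun w => g (X w)).
Proof.
move=> _ B mB; rewrite setTI.
rewrite (_ : _ @^-1` B = \bigcup_(t in [set t | B (g t)]) X @^-1` [set t]);
  last first.
  by apply/seteqP; split=> [w Bw|w [t /= Bt ->//]]; exists (X w).
rewrite bigcup_mkcond; apply: countable_bigcupT_measurable => [|t];
  first exact: countableP.
by case: ifP => // _; have [] := unifX t.
Qed.

(** [Rintegral_step] with error [0]: the fibres of [X] partition the space, and the integrand is
    constant on each. *)
Lemma expectation_uniform (a0 : T) (h : T -> R) : a0 \in A ->
  \int[P]_w h (X w) = (\sum_(t in A) h t) / #|A|%:R.
Proof.
move=> a0A.
have A0 : #|A|%:R != 0 :> R by rewrite pnatr_eq0 -lt0n; apply/card_gt0P;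
  exists a0.
have := @Rintegral_step _ _ _ P setT measurableT (probability_setT P) T
  (fun t => X @^-1` [set t]) h (fun t => (t \in A)%:R / #|A|%:R) (fun w =>
    h (X w))
  (\sum_t `|h t|) 0.
have -> : \sum_t h t * ((t \in A)%:R / #|A|%:R) = (\sum_(t in A) h t) / #|A|%:R.
  rewrite mulr_suml [RHS]big_mkcond/=; apply: eq_bigr => t _.
  by case: (t \in A); rewrite ?mul1r// mul0r mulr0.
move=> H; apply/eqP; rewrite -subr_eq0 -normr_le0; apply: H.
- exact: finite_valued_measurable.
- by move=> w _; rewrite (bigD1 (X w))//= lerDl sumr_ge0.
- by move=> t; have [] := unifX t.
- by move=> s t w /= <- <-.
- by move=> t w _ /= ->; rewrite subrr normr0.
- by move=> t; rewrite setIT le_eqVlt; have [_ tE] := unifX t; apply/orP; left;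
  apply/eqP; exact: esym tE.
- rewrite -mulr_suml -natr_sum -[X in (\sum_(i : T) X i)%N]/(fun i =>
  nat_of_bool (i \in A)).
  by rewrite -big_mkcond /= sum1_card divff.
Qed.

End FiniteValued.

Lemma id_square n : (1%g : 'S_n) \in Sq n.
Proof.
rewrite inE; apply/forallP => i; rewrite /is_record.
have -> : lr_max (1%g : 'S_n) i by apply/forallP => j; rewrite !perm1;
  exact/implyP.
by [].
Qed.

Lemma path_riemann_sum (R : realType) (d : measure_display)
    (Om : measurableType d) (P : probability Om R) (z : {RV P >-> R})
    (phi : permuton R -> R) (M e : R) :
  (forall A : set R, measurable A -> distribution P z A = uniform_prob (@ltr01
    R) A) ->
  continuous phi -> (forall mu, `|phi mu| <= M) -> 0 < e ->
  exists K : R, forall n, K <= n.+1%:R ->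
    `|\int[P]_w phi (rectangle_path (z w)) -
      \sum_(i < n.+1) phi (rectangle_path (i%:R / n.+1%:R)) * n.+1%:R^-1| <= e.
Proof.
move=> zU cphi phiM e0; have [dl dl0 H] := path_phi_uniform cphi e0.
exists dl^-1 => n Kn; have N0 : 0 < n.+1%:R :> R by rewrite ltr0n.
have Ndl : n.+1%:R^-1 <= dl by rewrite invf_ple.
have grid (i : nat) : i.+1%:R / n.+1%:R - i%:R / n.+1%:R = n.+1%:R^-1 :> R.
  by rewrite -mulrBl -natrB// subSnn mul1r.
have mphi : measurable_fun setT (fun t : R => phi (rectangle_path t)).
  apply: continuous_measurable_fun => t.
  apply: continuous_comp; [exact: rectangle_path_continuous|exact: cphi].
apply: (@Rintegral_step _ _ _ P setT measurableT (probability_setT P) _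
  (fun i : 'I_n.+1 => z @^-1` `[i%:R / n.+1%:R, i.+1%:R / n.+1%:R[)
  (fun i => phi (rectangle_path (i%:R / n.+1%:R))) (fun=> n.+1%:R^-1)
  (fun w => phi (rectangle_path (z w))) M) => //.
- exact: (measurableT_comp mphi).
- by move=> i; rewrite -[X in measurable X]setTI; apply: measurable_funP => //;
  exact: measurable_itv.
- move=> i j w /=; rewrite !in_itv/= => /andP[ix xi] /andP[jx xj].
  apply/val_inj/eqP => /=; rewrite eqn_leq.
  have := le_lt_trans ix xj; have := le_lt_trans jx xi.
  by rewrite !ltr_pM2r ?invr_gt0// !ltr_nat !ltnS => -> ->.
- move=> i w _ /=; rewrite in_itv/= => /andP[l r]; apply: H;
  apply: le_trans Ndl.
  by rewrite ger0_norm ?subr_ge0// -[leRHS](grid i) lerD2r ltW.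
- move=> i; rewrite setIT.
  rewrite [leRHS](_ : _ = distribution P z `[i%:R / n.+1%:R,
    i.+1%:R / n.+1%:R[)//.
  rewrite zU; last exact: measurable_itv.
  rewrite /uniform_prob; set B := [set` _].
  rewrite (eq_integral (fun=> 1%E)); last first.
    move=> x /set_mem; rewrite /B /= in_itv/= => /andP[ix xi].
    rewrite /uniform_pdf subr0 invr1 (le_trans _ ix) ?divr_ge0//=.
    rewrite (le_trans (ltW xi))// ler_pdivrMr// mul1r ler_nat.
    exact: ltn_ord.
  rewrite integral_cst//=; last exact: measurable_itv.
  rewrite /B mul1e lebesgue_measure_itv/= lte_fin ltr_pM2r ?invr_gt0// ltr_nat
    ltnSn.
  by rewrite -EFinB grid.
- by rewrite sumr_const card_ord -[LHS]mulr_natr mulVf// gt_eqF.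
Qed.

Lemma large_cvg (R : realType) (u : nat -> R) (l : R) :
  (forall e, 0 < e ->
     exists K : R, forall n, K <= n.+1%:R -> `|l - u n| <= e) ->
  u n @[n --> \oo] --> l.
Proof.
move=> H; apply/cvgrPdist_le => e e0; have [K HK] := H e e0.
exists (Num.truncn K) => // n /= Kn; apply: HK.
apply: ltW; apply: lt_le_trans (truncnS_gt K) _.
by rewrite ler_nat ltnS.
Qed.

Theorem theorem4p4 (R : realType)
    (d_ : nat -> measure_display) (Om_ : forall n, measurableType (d_ n))
    (P_ : forall n, probability (Om_ n) R) (sigma : forall n, Om_ n -> 'S_n.+1)
    (sigma_unif : forall n, uniform_random (P_ n) (sigma n) (Sq n.+1))
    (d : measure_display) (Om : measurableType d) (P : probability Om R)
    (z : {RV P >-> R}) (z01 : forall w, 0 <= z w <= 1)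
    (z_unif : forall A : set R, measurable A ->
      distribution P z A = uniform_prob (@ltr01 R) A) :
  cvg_in_distribution P_ (fun n w => perm_permuton R (sigma n w))
    P (fun w => rectangle_permuton (z01 w)).
Proof.
have pathE : (fun w => rectangle_permuton (z01 w)) =
    (fun w => rectangle_path (z w)).
  by apply/funext => w; exact: rectangle_pathE.
rewrite pathE; split.
- by move=> n; exact: (finite_valued_measurable (sigma_unif n)).
- apply: (@measurability _ _ Om (borel (permuton R)) setT _ (@open (permuton
  R))) => // _ [U oU <-]; rewrite setTI.
  rewrite -[X in measurable X]setTI -[X in _ `&` X]/(z @^-1` (@rectangle_path R
    @^-1` U)).
  apply: measurable_funP => //; apply: open_measurable.
  by move/continuousP : (@rectangle_path_continuous R); exact.
move=> phi cphi [M [_ HM]].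
have phiM mu : `|phi mu| <= M + 1 by apply: HM => //; rewrite ltrDl.
(* for [psi = 1] this is the asymptotics of [#|Sq n.+1|] *)
have lim (psi : permuton R -> R) (B : R) : continuous psi ->
    (forall mu, `|psi mu| <= B) ->
    (\sum_(s in Sq n.+1) psi (perm_permuton R s)) / (n.+1%:R * (nwords n)%:R)
      @[n --> \oo] --> \int[P]_w psi (rectangle_path (z w)).
  move=> cpsi psiB; apply: large_cvg => e e0;
    have e2 : 0 < e / 2 by rewrite divr_gt0.
  have [K1 H1] := sum_Sq_close cpsi psiB e2.
  have [K2 H2] := path_riemann_sum z_unif cpsi psiB e2.
  exists (Num.max K1 K2) => n; rewrite ge_max => /andP[/H1 {}H1 /H2 {}H2].
  have -> : e = e / 2 + e / 2 by lra.
  apply: le_trans (ler_distD _ _ _) (lerD H2 _).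
  rewrite -mulr_suml; move: H1.
  set S := \sum_(s in _) _; set Q := \sum_(i < _) _.
  have W0 : 0 < (nwords n)%:R :> R by rewrite ltr0n /nwords muln_gt0 !expn_gt0.
  have N0 : 0 < n.+1%:R :> R by rewrite ltr0n.
  have NW0 : 0 < n.+1%:R * (nwords n)%:R :> R by rewrite mulr_gt0.
  rewrite distrC => H1; rewrite -(ler_pM2r NW0) -[X in _ * X <=
    _](ger0_norm (ltW NW0)) -normrM.
  apply: le_trans H1; rewrite le_eqVlt; apply/orP; left; apply/eqP;
    congr (`|_|).
  by field; rewrite !gt_eqF.
(* The expectation is a quotient of two sums over [Sq n.+1], of [phi] and of [1], under the same
   normalization; [lim] gives the limit of each. *)
have E n : \int[P_ n]_w phi (perm_permuton R (sigma n w)) =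
    (\sum_(s in Sq n.+1) phi (perm_permuton R s)) / (n.+1%:R * (nwords n)%:R) *
    ((\sum_(s in Sq n.+1) 1) / (n.+1%:R * (nwords n)%:R))^-1.
  rewrite (expectation_uniform (sigma_unif n) (fun s =>
    phi (perm_permuton R s)) (id_square n.+1)).
  rewrite sumr_const; have W0 : 0 < (nwords n)%:R :> R by rewrite ltr0n /nwords
    muln_gt0 !expn_gt0.
  have S0 : 0 < #|Sq n.+1|%:R :> R.
    by rewrite ltr0n; apply/card_gt0P; exists 1%g; exact: id_square.
  by field; rewrite !gt_eqF// addr_gt0.
under eq_fun do rewrite E.
have -> : \int[P]_w phi (rectangle_path (z w)) =
    \int[P]_w phi (rectangle_path (z w)) * 1^-1.
  by rewrite invr1 mulr1.
apply: cvgM; first exact: lim phiM.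
apply: cvgV; first exact: oner_neq0.
have P1 : \int[P]_w (1 : R) = 1 := Rintegral_cst1 measurableT (probability_setT
  P) 1.
rewrite -[X in _ --> X]P1; apply: (lim (fun=> 1) 1);
  first exact: cst_continuous.
by move=> mu; rewrite normr1.
Qed.
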